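(* Let $\mathscr{M}$ be the set of all time-periodic Maxwell-Boltzmann distributions $M(t,x,v)$ with $m>0$, and let $$\mathscr{I}:=\Big\{\mathsf{V}=\Psi(F_0)\ \Big|\ F_0(x,v)\ge0,\ 0<\int_{\mathbb{R}^6}F_0(1+|x|^2+|v|^2)\,dx\,dv<\infty\Big\}.$$ There exists a bijection $\widetilde{\mathscr{F}}:\mathscr{I}\to\mathscr{M}$ such that $\Psi(\widetilde{\mathscr{F}}(\mathsf{V}))=\mathsf{V}$ for any $\mathsf{V}\in\mathscr{I}$. Moreover, if $M_i=\widetilde{\mathscr{F}}(\mathsf{V}_i)$ has the form of a time-periodic Maxwell-Boltzmann distribution with parameters $(m_i,y_i,z_i,a_i,b_i,c_i,\mathsf{R}_i)\in\mathbb{R}^+_{>0}\times\mathbb{R}^6\times\mathcal{O}$ for $i=1,2$, and $\|\mathsf{V}_1-\mathsf{V}_2\|_2\ll1$ (i.e. is sufficiently small), then there exists a constant $C(\mathsf{V}_1)$, depending only on $\mathsf{V}_1$, such that $$\|(m_1-m_2,\,y_1-y_2,\,z_1-z_2,\,a_1-a_2,\,b_1-b_2,\,c_1-c_2,\,\mathsf{R}_1-\mathsf{R}_2)\|_2\le C(\mathsf{V}_1)\|\mathsf{V}_1-\mathsf{V}_2\|_2,$$ $$\frac{M_1}{M_2}+\frac{M_2}{M_1}\le4\exp\Big\{C(\mathsf{V}_1)\|\mathsf{V}_1-\mathsf{V}_2\|_2(|x|^2+|v|^2+1)\Big\}.$$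
   Context: $\mathbb{R}^+=\{x\ge0\}$, $\mathbb{R}^+_{>0}=\{x>0\}$, $\mathbb{M}_3(\mathbb{R})$ is the set of real $3\times3$ matrices, $|\mathsf{R}|:=\sqrt{\mathsf{R}^\tau\mathsf{R}}$. $\mathcal{O}:=\{(a,b,c,\mathsf{R})\in\mathbb{R}^+\times\mathbb{R}\times\mathbb{R}^+\times\mathbb{M}_3(\mathbb{R})\,|\,ac-b^2>0,\ \mathsf{R}\text{ skew-symmetric},\ \mathrm{tr}(|\mathsf{R}|)<2\sqrt{ac-b^2}\}$. Put $(X(t),V(t)):=(x\cos t-v\sin t,\ x\sin t+v\cos t)$. A time-periodic Maxwell-Boltzmann distribution is a function of the form $$M(t,x,v)=m\frac{\sqrt{\det\mathsf{Q}}}{(2\pi)^3}\exp\Big\{-\tfrac12\big[a|X(t)-y|^2+2b(X(t)-y)\cdot(V(t)-z)+c|V(t)-z|^2+2(X(t)-y)^\tau\mathsf{R}(V(t)-z)\big]\Big\}$$ with $(m,y,z)\in\mathbb{R}^+\times\mathbb{R}^3\times\mathbb{R}^3$, $(a,b,c,\mathsf{R})\in\mathcal{O}$, $\mathsf{Q}:=(ac-b^2)\mathbb{I}+\mathsf{R}^2$. Conserved mapping: for $u,w\in\mathbb{R}^3$ let $u\wedge w:=uw^\tau-wu^\tau=(u_iw_j-u_jw_i)_{3\times3}$. For $F(t,x,v)$, $$\Psi(F(t)):=\int_{\mathbb{R}^3\times\mathbb{R}^3}F(t,x,v)\,\big(1,\,X(t),\,V(t),\,|X(t)|^2,\,X(t)\cdot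 V(t),\,|V(t)|^2,\,X(t)\wedge V(t)\big)^\tau dx\,dv .$$ For a function $F_0(x,v)$ (initial data, $t=0$), $\Psi(F_0)=\int F_0\,(1,x,v,|x|^2,x\cdot v,|v|^2,x\wedge v)^\tau dx\,dv$. For $M\in\mathscr{M}$, $\Psi(M(t))$ does not depend on $t$ and is denoted $\Psi(M)$. For a tuple of scalars, vectors and matrices, $\|\cdot\|_2$ is the square root of the sum of the squares of all entries; in particular $\|\mathsf{V}\|_2^2=\sum_{i=1}^7\|\mathsf{V}_i\|_2^2$ for $\mathsf{V}=(\mathsf{V}_1,\dots,\mathsf{V}_7)\in\mathbb{R}^+\times\mathbb{R}^3\times\mathbb{R}^3\times\mathbb{R}^+\times\mathbb{R}\times\mathbb{R}^+\times\mathbb{M}_3(\mathbb{R})$. The smallness threshold in ''$\ll1$'' may depend on $\mathsf{V}_1$. *)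

(* Defs.v *)
From HB Require Import structures.
From mathcomp Require Import all_boot all_order all_algebra.
From mathcomp Require Import all_classical all_reals all_analysis.

Set Implicit Arguments.
Unset Strict Implicit.
Unset Printing Implicit Defensive.

Import Order.TTheory GRing.Theory Num.Theory.
Import numFieldNormedType.Exports.

Local Open Scope classical_set_scope.
Local Open Scope ring_scope.

(* Both the moment vectors (V_1, ..., V_7) and the parameter lists
   (m, y, z, a, b, c, R) have this shape.  Non-negativity of some of the scalar
   entries is not part of the type: it is required in [calO] and
   [maxwell_params], and holds automatically in [calI]. *)
Definition septuple (R : realType) : Type :=
  (R * 'cV[R]_3 * 'cV[R]_3 * R * R * R * 'M[R]_3)%type.

Definition dot (R : realType) (u w : 'cV[R]_3) : R := \sum_(i < 3) u i 0 * w i 0.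

Definition sqn (R : realType) (u : 'cV[R]_3) : R := dot u u.

Definition wedge (R : realType) (u w : 'cV[R]_3) : 'M[R]_3 :=
  u *m w^T - w *m u^T.

(* The library norms on products and matrices are sup norms. *)
Definition norm2 (R : realType) (p : septuple R) : R :=
  let '(s1, u1, u2, s2, s3, s4, A) := p in
  Num.sqrt (s1 ^+ 2 + sqn u1 + sqn u2 + s2 ^+ 2 + s3 ^+ 2 + s4 ^+ 2
            + \sum_(i < 3) \sum_(j < 3) A i j ^+ 2).

Definition psd (R : realType) (S : 'M[R]_3) : Prop :=
  S^T = S /\ forall u : 'cV[R]_3, 0 <= dot u (S *m u).

(* sqrt (A^T A), the unique positive semidefinite S with S^2 = A^T A; it exists
   for every A, so the default value 0 is never used. *)
Definition absmx (R : realType) (A : 'M[R]_3) : 'M[R]_3 :=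
  xget 0 [set S | psd S /\ S *m S = A^T *m A].

Definition calO (R : realType) (a b c : R) (A : 'M[R]_3) : Prop :=
  [/\ 0 <= a, 0 <= c, a * c - b ^+ 2 > 0, A^T = - A
    & \tr (absmx A) < 2 * Num.sqrt (a * c - b ^+ 2)].

Definition Xt (R : realType) (t : R) (x v : 'cV[R]_3) : 'cV[R]_3 :=
  cos t *: x - sin t *: v.

Definition Vt (R : realType) (t : R) (x v : 'cV[R]_3) : 'cV[R]_3 :=
  sin t *: x + cos t *: v.

Definition maxwell (R : realType) (p : septuple R)
    (t : R) (x v : 'cV[R]_3) : R :=
  let '(m, y, z, a, b, c, A) := p in
  let Q := (a * c - b ^+ 2)%:M + A *m A in
  let X := Xt t x v - y in
  let V := Vt t x v - z in
  m * (Num.sqrt (\det Q) / (2 * pi) ^+ 3) *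
  expR (- (2^-1 * (a * sqn X + 2 * b * dot X V + c * sqn V
                   + 2 * dot X (A *m V)))).

Definition maxwell_params (R : realType) (p : septuple R) : Prop :=
  let '(m, y, z, a, b, c, A) := p in 0 < m /\ calO a b c A.

Definition calM (R : realType) : set (R -> 'cV[R]_3 -> 'cV[R]_3 -> R) :=
  [set M | exists2 p : septuple R, maxwell_params p & M = maxwell p].

(* The sigma-finite structure on m1 \x m2 is not found by inference in the
   library: it is shadowed there by the one on products of subprobabilities. *)
Lemma sigma_finite_product (d1 d2 : measure_display) (T1 : measurableType d1)
    (T2 : measurableType d2) (R : realType)
    (m1 : {sigma_finite_measure set T1 -> \bar R})
    (m2 : {sigma_finite_measure set T2 -> \bar R}) :
  sigma_finite setT (m1 \x m2)%E.
Proof.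
have /sigma_finiteP[F [TF ndF Foo]] := sigma_finiteT m1.
have /sigma_finiteP[G [TG ndG Goo]] := sigma_finiteT m2.
exists (fun n => F n `*` G n).
  rewrite -setXTT TF TG predeqE => -[x y]; split.
    move=> [/= [n _ Fnx] [k _ Gky]]; exists (maxn n k) => //; split.
    - by move: x Fnx; exact/subsetPset/ndF/leq_maxl.
    - by move: y Gky; exact/subsetPset/ndG/leq_maxr.
  by move=> [n _ []/= ? ?]; split; exists n.
move=> k; have [? ?] := Foo k; have [? ?] := Goo k.
split; first exact: measurableX.
by rewrite product_measure1E// lte_mul_pinfty// ge0_fin_numE.
Qed.

Definition leb2 (R : realType) := (@lebesgue_measure R \x @lebesgue_measure R)%E.
HB.instance Definition _ (R : realType) := Measure.on (@leb2 R).
HB.instance Definition _ (R : realType) :=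
  Measure_isSigmaFinite.Build _ _ _ (@leb2 R)
    (sigma_finite_product (@lebesgue_measure R) (@lebesgue_measure R)).

Definition leb3 (R : realType) := (@leb2 R \x @lebesgue_measure R)%E.
HB.instance Definition _ (R : realType) := Measure.on (@leb3 R).
HB.instance Definition _ (R : realType) :=
  Measure_isSigmaFinite.Build _ _ _ (@leb3 R)
    (sigma_finite_product (@leb2 R) (@lebesgue_measure R)).

Definition leb6 (R : realType) := (@leb3 R \x @leb3 R)%E.
HB.instance Definition _ (R : realType) := Measure.on (@leb6 R).
HB.instance Definition _ (R : realType) :=
  Measure_isSigmaFinite.Build _ _ _ (@leb6 R)
    (sigma_finite_product (@leb3 R) (@leb3 R)).

Local Notation mR3 R :=
  (measurableTypeR R * measurableTypeR R * measurableTypeR R)%type.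

Definition vec3 (R : realType) (p : mR3 R) : 'cV[R]_3 :=
  \col_(i < 3) [:: p.1.1 : R; p.1.2 : R; p.2 : R]`_i.

Definition on6 (R : realType) (T : Type) (f : 'cV[R]_3 -> 'cV[R]_3 -> T)
    (q : mR3 R * mR3 R) : T := f (vec3 q.1) (vec3 q.2).

Definition int6 (R : realType) (f : 'cV[R]_3 -> 'cV[R]_3 -> R) : R :=
  Rintegral (@leb6 R) setT (on6 f).

Definition moments (R : realType) (X V : 'cV[R]_3 -> 'cV[R]_3 -> 'cV[R]_3)
    (f : 'cV[R]_3 -> 'cV[R]_3 -> R) : septuple R :=
  (int6 f,
   \col_i int6 (fun x v => f x v * X x v i 0),
   \col_i int6 (fun x v => f x v * V x v i 0),
   int6 (fun x v => f x v * sqn (X x v)),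
   int6 (fun x v => f x v * dot (X x v) (V x v)),
   int6 (fun x v => f x v * sqn (V x v)),
   \matrix_(i, j) int6 (fun x v => f x v * wedge (X x v) (V x v) i j)).

Definition Psi (R : realType) (F : R -> 'cV[R]_3 -> 'cV[R]_3 -> R) (t : R) :
  septuple R := moments (Xt t) (Vt t) (F t).

Definition Psi0 (R : realType) (F0 : 'cV[R]_3 -> 'cV[R]_3 -> R) : septuple R :=
  moments (fun x _ => x) (fun _ v => v) F0.

(* Finiteness of the weighted mass makes every integral in [Psi0 F0] convergent. *)
Definition calI (R : realType) : set (septuple R) :=
  [set V | exists F0 : 'cV[R]_3 -> 'cV[R]_3 -> R,
    [/\ measurable_fun setT (on6 F0),
        forall x v, 0 <= F0 x v,
        (0 < \int[@leb6 R]_q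
           (on6 (fun x v => F0 x v * (1 + sqn x + sqn v)) q)%:E < +oo)%E
      & V = Psi0 F0]].

(* Main.v *)
Require Import Defs.
From mathcomp Require Import all_boot all_order all_algebra.
From mathcomp Require Import all_classical all_reals all_analysis.
From mathcomp Require Import measurable_realfun.
From mathcomp Require Import ring lra.

(** The phase-space rotation (x, v) -> (X(t), V(t)) maps the family of Maxwell-
    Boltzmann distributions into itself, so it suffices to understand them at
    t = 0.  There they are Gaussians on R^6 whose precision matrix has the 3 x 3
    blocks a, b + A, b - A and c.  These blocks commute, so the covariance
    matrix has blocks c Q^-1, - Q^-1 (b + A), - Q^-1 (b - A) and a Q^-1, with
    Q = D + A^2 and D = a c - b^2.  With rho the squared length of the axial
    vector of A ([axsq]), the eigenvalues of Q are D, D - rho, D - rho, so its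
    inverse is a polynomial in A and all conserved moments are explicit
    ([Psi_maxwell]): about the mean and per unit of mass they are c tau, - b tau,
    a tau and - 2 (D - rho)^-1 A, where tau = 1 / D + 2 / (D - rho).

    Integrals over R^6 are evaluated by a triangular affine substitution that
    turns the Gaussian into the standard one ([gaussian_has_moments]); the
    triangular form reduces the change of variables to the one-dimensional one
    and Tonelli.

    The map from parameters to moments is inverted in closed form
    ([moments_params]).  Its range consists of the data with positive mass and
    second moments s, u and axsq W < s u - r^2, where s, r, u, W are the central
    moments of |x|^2, x . v, |v|^2 and x /\ v.  Every admissible density
    satisfies these conditions by a strict Cauchy-Schwarz inequality, strict
    because a density does not charge null sets ([calI_admissible]).  Hence
    moments of densities, moments of Maxwell-Boltzmann distributions and the
    range just described coincide, and V -> maxwell (moments_params V) is the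
    required bijection.

    For the stability estimate, the inverse is built from field operations and
    square roots that are nonsingular at an admissible point, so it is Lipschitz
    there ([calm_norm2_params]).  The exponent is a polynomial in the parameters
    whose coefficients are bounded by multiples of 1 + |X|^2 + |V|^2, which
    equals 1 + |x|^2 + |v|^2, and the normalizing factors have quotient at most
    2 near V1 ([maxwell_ratio]). *)

Import Order.TTheory GRing.Theory Num.Theory.
Import numFieldNormedType.Exports.

Local Open Scope classical_set_scope.
Local Open Scope ring_scope.

Set Implicit Arguments.
Unset Strict Implicit.

Local Notation mR3 R :=
  (measurableTypeR R * measurableTypeR R * measurableTypeR R)%type.
Local Notation o2 := (@Ordinal 3 2 isT).

(** * Maps that scale a measure by a constant *)

(** The image of mu under f is k times mu; for Lebesgue measure and an
    affine map, k is the inverse of the absolute value of its determinant. *)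
Definition scales d (T : measurableType d) (R : realType)
    (mu : set T -> \bar R) (f : T -> T) (k : R) : Prop :=
  [/\ measurable_fun setT f, 0 < k
    & forall A, measurable A -> mu (f @^-1` A) = (k%:E * mu A)%E].

Section scales.
Context d (T : measurableType d) (R : realType).
Variables (mu : {measure set T -> \bar R}) (th : T -> T) (k : R).
Hypothesis sth : scales mu th k.

Lemma scales_ge0_integral (f : T -> \bar R) :
  measurable_fun setT f -> (forall x, 0 <= f x)%E ->
  (\int[mu]_x f (th x) = k%:E * \int[mu]_x f x)%E.
Proof.
case: sth => mth k0 thE mf f0.
have := @ge0_integral_pushforward _ _ _ _ _ _ mth mu setT f measurableT mf.
rewrite preimage_setT => <-; last by [].
have k0' : 0 <= k by exact: ltW.
rewrite -(ge0_integral_mscale _ measurableT (NngNum k0'))//; apply: eq_measure_integral.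
by move=> A mA _; exact: thE.
Qed.

(** Change of variables for signed functions.  Integrability is assumed after
    the substitution because that is where the integrand becomes explicit. *)
Lemma scales_integral (f : T -> R) :
  measurable_fun setT f -> mu.-integrable setT (EFin \o (f \o th)) ->
  mu.-integrable setT (EFin \o f) /\
  Rintegral mu setT f = k^-1 * Rintegral mu setT (f \o th).
Proof.
move=> mf intf; case: (sth) => mth k0 thE.
have mEf : measurable_fun setT (EFin \o f) by exact/measurable_EFinP.
have If : mu.-integrable setT (EFin \o f).
  apply/integrableP; split => //.
  have := @scales_ge0_integral (abse \o (EFin \o f)).
  move=> /(_ (measurableT_comp (@abse_measurable _ _) mEf)).
  move=> /(_ (fun=> abse_ge0 _)) H.
  move/integrableP : intf => [_]; rewrite [X in (X < _)%E -> _]H => H2.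
  rewrite ltNge; apply/negP; rewrite leye_eq => /eqP infty.
  by move: H2; rewrite infty gt0_muley.
split => //.
have E : (\int[mu]_x (f (th x))%:E = k%:E * \int[mu]_x (f x)%:E)%E.
  rewrite [LHS]integralE [in RHS]integralE.
  have P := scales_ge0_integral (measurable_funepos mEf) (funepos_ge0 _).
  have N := scales_ge0_integral (measurable_funeneg mEf) (funeneg_ge0 _).
  transitivity (k%:E * \int[mu]_x ((EFin \o f)^\+%E x)
                - k%:E * \int[mu]_x ((EFin \o f)^\-%E x))%E.
    by rewrite -P -N; congr (_ - _)%E; apply: eq_integral => x _;
      rewrite ?funeposE ?funenegE.
  rewrite [RHS]muleBr//; apply: fin_num_adde_defl.
  rewrite fin_numN; have /= := integrable_neg_fin_num measurableT If.
  by apply.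
rewrite /Rintegral/= E.
by rewrite fineM// ?mulKf ?gt_eqF//; exact: integrable_fin_num.
Qed.

End scales.

(** By Tonelli, sections scale by l and the base by k.  Since the second factor
    may depend on the first variable, iterating this lemma gives the change of
    variables for triangular affine maps, which is the only one needed. *)
Lemma scales_fibered d1 d2 (T1 : measurableType d1) (T2 : measurableType d2)
    (R : realType) (m1 : {measure set T1 -> \bar R})
    (m2 : {sigma_finite_measure set T2 -> \bar R})
    (f : T1 -> T1) (g : T1 -> T2 -> T2) (k l : R) :
  scales m1 f k -> (forall x, scales m2 (g x) l) ->
  measurable_fun setT (fun q : T1 * T2 => g q.1 q.2) ->
  scales (m1 \x m2)%E (fun q => (f q.1, g q.1 q.2)) (k * l).
Proof.
move=> sf sg mg; case: (sf) => mf k0 fE.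
have l0 : 0 < l by case: (sg point).
have mfg : measurable_fun setT (fun q : T1 * T2 => (f q.1, g q.1 q.2)).
  by apply: measurable_fun_pair => //; exact: measurableT_comp.
split => //; first exact: mulr_gt0.
move=> A mA; rewrite /product_measure1 /=.
transitivity (\int[m1]_x (l%:E * (m2 \o xsection A) (f x)))%E.
  apply: eq_integral => x _ /=.
  have [_ _ gE] := sg x; rewrite -gE; last exact: measurable_xsection.
  congr (m2 _); apply/seteqP; split => y /=; rewrite /xsection/= !inE//.
have mx := measurable_fun_xsection m2 mA.
rewrite (@scales_ge0_integral _ _ _ _ _ _ sf (fun x => l%:E * (m2 \o xsection A) x)%E).
- rewrite ge0_integralZl//; first by rewrite muleA -EFinM.
  by rewrite lee_fin ltW.
- apply: measurable_funeM => //; exact: mx.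
- by move=> x; rewrite mule_ge0// lee_fin ltW.
Qed.

Lemma scales_affine (R : realType) (s t : R) : s != 0 ->
  scales (@lebesgue_measure R) (fun x => s * x + t) `|s|^-1.
Proof.
move=> s0.
have ns : 0 < `|s| by rewrite normr_gt0.
have mth : measurable_fun setT (fun x : measurableTypeR R =>
  s * x + t : measurableTypeR R).
  by apply: measurable_funD => //; apply: measurable_funM.
split; [exact: mth|by rewrite invr_gt0|].
pose mu : {measure set (measurableTypeR R) -> \bar R} :=
  mscale (NngNum (ltW ns)) (pushforward (@lebesgue_measure R)
  (fun x : measurableTypeR R => s * x + t : measurableTypeR R)).
suff muE A : measurable A -> @lebesgue_measure R A = mu mth A.
  move=> A mA; rewrite (muE _ mA) /= /mscale/= muleA -EFinM mulVf ?gt_eqF//.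
  by rewrite mul1e.
move=> mA; apply: lebesgue_measure_unique => // _ [[a b] _ <-] /=.
rewrite /mscale/= /pushforward/=.
have [s_lt0|s_gt0|s_eq0] := ltgtP s 0; last by rewrite s_eq0 eqxx in s0.
- rewrite (_ : _ @^-1` _ = `[(b - t) / s, (a - t) / s[%classic); last first.
    apply/seteqP; split => x /=; rewrite !in_itv/=.
      by rewrite ler_ndivrMr// ltr_ndivlMr// lerBrDr ltrBlDr mulrC andbC.
    by rewrite ler_ndivrMr// ltr_ndivlMr// lerBrDr ltrBlDr mulrC andbC.
  rewrite !lebesgue_measure_itv/= !lte_fin ltr_ndivlMr// divfK// ltrD2r.
  case: ifP => _; last by rewrite mule0.
  rewrite -!EFinB -EFinM ltr0_norm//; congr EFin.
  by field.
- rewrite (_ : _ @^-1` _ = `](a - t) / s, (b - t) / s]%classic); last first.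
    apply/seteqP; split => x /=; rewrite !in_itv/=.
      by rewrite ler_pdivlMr// ltr_pdivrMr// lerBrDr ltrBlDr mulrC.
    by rewrite ler_pdivlMr// ltr_pdivrMr// lerBrDr ltrBlDr mulrC.
  rewrite !lebesgue_measure_itv/= !lte_fin ltr_pdivrMr// divfK// ltrD2r.
  case: ifP => _; last by rewrite mule0.
  rewrite -!EFinB -EFinM gtr0_norm//; congr EFin.
  by field.
Qed.

(** * Products of integrals and the moments of the normal law *)

Section tensor.
Context d1 d2 (T1 : measurableType d1) (T2 : measurableType d2) (R : realType).
Variables (m1 : {sigma_finite_measure set T1 -> \bar R})
          (m2 : {sigma_finite_measure set T2 -> \bar R}).
Variables (f1 : T1 -> R) (f2 : T2 -> R).
Hypotheses (if1 : m1.-integrable setT (EFin \o f1))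
           (if2 : m2.-integrable setT (EFin \o f2)).

Lemma integrable_tensor :
  (m1 \x m2)%E.-integrable setT (EFin \o (fun q => f1 q.1 * f2 q.2)).
Proof.
have /measurable_EFinP mf1 := measurable_int _ if1.
have /measurable_EFinP mf2 := measurable_int _ if2.
apply/integrable12ltyP.
  apply/measurable_EFinP; apply: measurable_funM.
    exact: (measurableT_comp mf1 measurable_fst).
  exact: (measurableT_comp mf2 measurable_snd).
under eq_integral => x _.
  under eq_integral => y _ do rewrite /= normrM EFinM.
  rewrite ge0_integralZl//; last by apply/measurable_EFinP; exact: measurableT_comp.
  over.
rewrite ge0_integralZr//.
- apply: lte_mul_pinfty.
  + exact: integral_ge0.
  + have /integrableP[_] := if1; rewrite ge0_fin_numE//.
    exact: integral_ge0.
  + by have /integrableP[_] := if2.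
- by apply/measurable_EFinP; exact: measurableT_comp.
- exact: integral_ge0.
Qed.

Lemma Rintegral_tensor :
  Rintegral (m1 \x m2)%E setT (fun q => f1 q.1 * f2 q.2) =
  Rintegral m1 setT f1 * Rintegral m2 setT f2.
Proof.
rewrite /Rintegral -(integral12_prod_meas1 integrable_tensor)/= /fubini_F/=.
under eq_integral => x _.
  under eq_integral => y _ do rewrite /= EFinM.
  rewrite integralZl//.
  rewrite -[X in (_ * X)%E]fineK; last exact: integrable_fin_num.
  over.
rewrite integralZr// -[X in fine (X * _)%E]fineK //.
exact: integrable_fin_num.
Qed.

End tensor.

Definition phi {R : realType} (x : R) : R :=
  (Num.sqrt (2 * pi))^-1 * expR (- (2^-1 * x ^+ 2)).

Section normal_moments.
Context {R : realType}.
Local Notation mu := (@lebesgue_measure R).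
Implicit Types x u : R.

Lemma phi_ge0 x : 0 <= phi x.
Proof. by rewrite mulr_ge0 ?expR_ge0 ?invr_ge0 ?sqrtr_ge0. Qed.

Lemma phi_normal_pdf : phi = normal_pdf (0 : R) 1.
Proof.
apply/funext => x; rewrite /normal_pdf (negbTE (oner_neq0 _)) /phi.
rewrite /normal_peak /normal_fun; congr (_ * expR _).
  by congr (Num.sqrt _)^-1; ring.
by rewrite subr0; field.
Qed.

Lemma measurable_phi : measurable_fun setT (phi : measurableTypeR R -> R).
Proof. rewrite phi_normal_pdf; exact: measurable_normal_pdf. Qed.

Lemma integrable_phi : mu.-integrable setT (EFin \o phi).
Proof. rewrite phi_normal_pdf; exact: integrable_normal_pdf. Qed.

Lemma Rintegral_phi : Rintegral mu setT phi = 1.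
Proof. by rewrite phi_normal_pdf /Rintegral integral_normal_pdf. Qed.

Lemma Rintegral_linear (s : R) (f : R -> R) : s != 0 ->
  measurable_fun setT (f : measurableTypeR R -> R) ->
  mu.-integrable setT (EFin \o f) ->
  mu.-integrable setT (EFin \o (fun x => f (s * x))) /\
  Rintegral mu setT (fun x => f (s * x)) = `|s|^-1 * Rintegral mu setT f.
Proof.
move=> s0 mf intf.
have sV0 : s^-1 != 0 by rewrite invr_eq0.
have sc := scales_affine (0 : R) sV0.
have E : f = (fun x => f (s * x)) \o (fun x => s^-1 * x + 0).
  by apply/funext => x /=; rewrite addr0 mulVKf.
have := scales_integral sc (f := (fun x => f (s * x))).
rewrite -E => -[||intg ->] //.
  apply: (measurableT_comp mf); exact: measurable_funM.
by split => //; rewrite normfV !invrK.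
Qed.

(** The comparison with a wider Gaussian makes the second moment finite. *)
Lemma phi_square_le x : x ^+ 2 * phi x <= 8 / 3 * phi (2^-1 * x).
Proof.
have -> : phi x = phi (2^-1 * x) * expR (- (3 / 8 * x ^+ 2)).
  by rewrite /phi -[RHS]mulrA -expRD; congr (_ * expR _); field.
rewrite mulrCA [leRHS]mulrC ler_wpM2l ?phi_ge0//.
rewrite expRN -ler_pdivlMr ?invr_gt0 ?expR_gt0// invrK.
have := expR_ge1Dx (3 / 8 * x ^+ 2).
lra.
Qed.

Lemma integrable_phi2 : mu.-integrable setT (EFin \o (fun x => x ^+ 2 * phi x)).
Proof.
have [|i2 _] := @Rintegral_linear 2^-1 phi _ measurable_phi integrable_phi => //.
have := integrableZl measurableT (8/3) i2.
apply: le_integrable => //.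
  apply/measurable_EFinP; apply: measurable_funM; last exact: measurable_phi.
  exact: measurable_funX.
move=> x _ /=; rewrite lee_fin ger0_norm; last first.
  by rewrite mulr_ge0 ?phi_ge0// sqr_ge0.
exact: (le_trans (phi_square_le x) (ler_norm _)).
Qed.

Lemma integrable_phi1 : mu.-integrable setT (EFin \o (fun x => x * phi x)).
Proof.
have := integrableD measurableT integrable_phi integrable_phi2.
apply: le_integrable => //.
  by apply/measurable_EFinP; apply: measurable_funM => //; exact: measurable_phi.
move=> x _ /=; rewrite lee_fin normrM (ger0_norm (phi_ge0 _)).
rewrite [leRHS]ger0_norm; last first.
  by rewrite addr_ge0 ?phi_ge0// mulr_ge0 ?phi_ge0// sqr_ge0.
rewrite -[X in X + _]mul1r -mulrDl ler_wpM2r ?phi_ge0//.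
rewrite -real_normK ?num_real//; nra.
Qed.

Lemma Rintegral_phi1 : Rintegral mu setT (fun x => x * phi x) = 0.
Proof.
have [||_] := @Rintegral_linear (-1) (fun x => x * phi x) _ _ integrable_phi1.
- by rewrite oppr_eq0 oner_neq0.
- by apply: measurable_funM => //; exact: measurable_phi.
have -> : (fun x => -1 * x * phi (-1 * x)) = (fun x => -1 * (x * phi x)).
  by apply/funext => x; rewrite /phi (_ : (-1 * x) ^+ 2 = x ^+ 2); ring.
rewrite RintegralZl//; last exact: integrable_phi1.
rewrite normrN normr1 invr1; lra.
Qed.

(** Integrate the tangent-line bound exp (- s) >= 1 - s, applied to the factor
    that turns phi x into phi (u x). *)
Lemma phi2_bound u : 0 < u ->
  1 - (u ^+ 2 - 1) / 2 * Rintegral mu setT (fun x => x ^+ 2 * phi x) <= u^-1.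
Proof.
move=> u0; have un0 : u != 0 by rewrite gt_eqF.
have [iu Eu] := Rintegral_linear un0 measurable_phi integrable_phi.
rewrite Rintegral_phi mulr1 gtr0_norm// in Eu; rewrite -Eu.
rewrite -{1}Rintegral_phi -RintegralZl//; last exact: integrable_phi2.
rewrite -RintegralB//; last 2 first.
- exact: integrable_phi.
- exact: (integrableZl measurableT _ integrable_phi2).
apply: le_Rintegral => //.
  exact: (integrableB measurableT integrable_phi
    (integrableZl measurableT _ integrable_phi2)).
move=> x _; have -> : phi (u * x) = phi x * expR (- ((u ^+ 2 - 1) / 2 * x ^+ 2)).
  by rewrite /phi -[RHS]mulrA -expRD; congr (_ * expR _); field.
rewrite mulrA -[X in X - _]mul1r -mulrBl mulrC ler_wpM2l ?phi_ge0//.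
exact: expR_ge1Dx.
Qed.

(** Differentiating the integral of phi (u x) with respect to u at 1 would give
    the result; [phi2_bound] replaces the derivative by a one-sided estimate
    valid for every u > 0, whose sign changes at u = 1. *)
Lemma Rintegral_phi2 : Rintegral mu setT (fun x => x ^+ 2 * phi x) = 1.
Proof.
set M := Rintegral _ _ _.
have H u : 0 < u -> (u - 1) * 2 <= (u - 1) * (u * (u + 1) * M).
  move=> u0; have := phi2_bound u0; rewrite -/M.
  rewrite -(ler_pM2l u0) divff ?gt_eqF// => le1.
  have : (u - 1) * 2 <= (u - 1) * (u * (u + 1) * M) by lra.
  by [].
apply/eqP; rewrite eq_le; apply/andP; split; rewrite leNgt; apply/negP => M1.
(* Any u < 1 with u (u + 1) M > 2 contradicts H; this one stays above 1/2. *)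
- pose u := 1 - (M - 1) / (2 * M).
  have M0 : 0 < M by lra.
  have d0 : 0 < (M - 1) / (2 * M) by rewrite divr_gt0; lra.
  have d1 : (M - 1) / (2 * M) < 1 / 2 by rewrite ltr_pdivrMr; lra.
  have dM : (M - 1) / (2 * M) * M = (M - 1) / 2 by field; rewrite gt_eqF.
  set d := (M - 1) / (2 * M) in d0 d1 dM u *.
  have : (u - 1) * 2 <= (u - 1) * (u * (u + 1) * M) by apply: H; rewrite /u; lra.
  rewrite (_ : u - 1 = - d); last by rewrite /u; ring.
  rewrite !mulNr lerN2 ler_pM2l// /u.
  have -> : (1 - d) * (1 - d + 1) * M = 2 * M - 3 * (d * M) + d * (d * M) by ring.
  rewrite dM; nra.
- have M0 : 0 <= M.
    by apply: Rintegral_ge0 => x _; rewrite mulr_ge0 ?sqr_ge0 ?phi_ge0.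
  (* Here u = 1 + d > 1 and M = 1 - 4 d gives u (u + 1) M < 2. *)
  pose d := (1 - M) / 4; have d0 : 0 < d by rewrite /d; lra.
  have := H (1 + d) (addr_gt0 ltr01 d0).
  rewrite (addrC 1 d) addrK ler_pM2l// (_ : M = 1 - 4 * d); last by rewrite /d; field.
  nra.
Qed.
End normal_moments.

(** * Moments of the standard Gaussian *)

(** Integrability and value are carried together, so that the value of a
    combination never raises a separate integrability question. *)
Definition has_int d (T : measurableType d) (R : realType)
    (mu : {measure set T -> \bar R}) (f : T -> R) (c : R) : Prop :=
  mu.-integrable setT (EFin \o f) /\ Rintegral mu setT f = c.

Section has_int.
Context d (T : measurableType d) (R : realType) (mu : {measure set T -> \bar R}).
Implicit Types (f g : T -> R) (c k : R).

Lemma has_int_eq f g c e : has_int mu f c -> f =1 g -> c = e -> has_int mu g e.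
Proof. by move=> h /funext <- <-. Qed.

Lemma has_int0 : has_int mu (fun=> 0) 0.
Proof.
split; first exact: integrable0.
by rewrite /Rintegral integral0.
Qed.

Lemma has_intD f g c e : has_int mu f c -> has_int mu g e ->
  has_int mu (fun x => f x + g x) (c + e).
Proof.
move=> [If <-] [Ig <-]; split; last exact: RintegralD.
exact: (integrableD measurableT If Ig).
Qed.

Lemma has_intZ k f c : has_int mu f c -> has_int mu (fun x => k * f x) (k * c).
Proof.
move=> [If <-]; split; last exact: RintegralZl.
exact: (integrableZl measurableT k If).
Qed.

Lemma has_intB f g c e : has_int mu f c -> has_int mu g e ->
  has_int mu (fun x => f x - g x) (c - e).
Proof.
move=> hf hg; apply: (has_int_eq (has_intD hf (has_intZ (-1) hg))) => [x|];
  by rewrite mulN1r.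
Qed.

Lemma has_int_sum (I : Type) (r : seq I) (P : pred I) (f : I -> T -> R) (c : I -> R) :
  (forall i, has_int mu (f i) (c i)) ->
  has_int mu (fun x => \sum_(i <- r | P i) f i x) (\sum_(i <- r | P i) c i).
Proof.
move=> h; elim: r => [|i r IH].
  by apply: (has_int_eq has_int0) => [x|]; rewrite big_nil.
rewrite big_cons; case: ifPn => Pi.
  by apply: (has_int_eq (has_intD (h i) IH)) => // x; rewrite big_cons Pi.
by apply: (has_int_eq IH) => // x; rewrite big_cons (negbTE Pi).
Qed.

Lemma has_int_scales (th : T -> T) k f c : scales mu th k ->
  measurable_fun setT f -> has_int mu (f \o th) c -> has_int mu f (k^-1 * c).
Proof.
by move=> sth mf [If <-]; have [] := scales_integral sth mf If.
Qed.

End has_int.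

Lemma has_int_tensor d1 d2 (T1 : measurableType d1) (T2 : measurableType d2)
    (R : realType) (m1 : {sigma_finite_measure set T1 -> \bar R})
    (m2 : {sigma_finite_measure set T2 -> \bar R}) (f : T1 -> R) (g : T2 -> R)
    (c e : R) : has_int m1 f c -> has_int m2 g e ->
  has_int (m1 \x m2)%E (fun q => f q.1 * g q.2) (c * e).
Proof.
move=> [If <-] [Ig <-]; split; [exact: integrable_tensor|exact: Rintegral_tensor].
Qed.

Section gauss3.
Context {R : realType}.
Local Notation mu := (@lebesgue_measure R).

Lemma vec3E (p : mR3 R) :
  (vec3 p 0 0 = p.1.1) * (vec3 p 1 0 = p.1.2) * (vec3 p (@Ordinal 3 2 isT) 0 = p.2).
Proof. by rewrite /vec3 !mxE. Qed.

Definition gauss3 (p : mR3 R) : R := phi p.1.1 * phi p.1.2 * phi p.2.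

Let m_ (n : nat) : R := if n is 1 then 0 else 1.

Lemma has_int_phi n : (n <= 2)%N -> has_int mu (fun x => x ^+ n * phi x) (m_ n).
Proof.
case: n => [_|[_|[_|//]]] /=.
- have h : has_int mu phi 1.
    by split; [exact: integrable_phi|exact: Rintegral_phi].
  by apply: (has_int_eq h) => // x; rewrite expr0 mul1r.
- by split; [exact: integrable_phi1|exact: Rintegral_phi1].
- by split; [exact: integrable_phi2|exact: Rintegral_phi2].
Qed.

(** The density is a product, so a monomial integrates to the product of the
    one-dimensional moments 1, 0, 1. *)
Lemma has_int_gauss3_monom i j k : (i <= 2)%N -> (j <= 2)%N -> (k <= 2)%N ->
  has_int (@leb3 R) (fun p => p.1.1 ^+ i * p.1.2 ^+ j * p.2 ^+ k * gauss3 p)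
    (m_ i * m_ j * m_ k).
Proof.
move=> i2 j2 k2.
have h2 : has_int (@leb2 R)
    (fun q => q.1 ^+ i * phi q.1 * (q.2 ^+ j * phi q.2)) (m_ i * m_ j).
  exact: (has_int_tensor (has_int_phi i2) (has_int_phi j2)).
have h3 : has_int (@leb3 R) (fun q => (q.1.1 ^+ i * phi q.1.1 *
    (q.1.2 ^+ j * phi q.1.2)) * (q.2 ^+ k * phi q.2)) (m_ i * m_ j * m_ k).
  exact: (has_int_tensor h2 (has_int_phi k2)).
apply: (has_int_eq h3) => // p /=; rewrite /gauss3; ring.
Qed.

Lemma ord3P (P : 'I_3 -> Prop) : P 0 -> P 1 -> P (@Ordinal 3 2 isT) -> forall i, P i.
Proof.
move=> P0 P1 P2 [[|[|[|//]]] lti].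
- by rewrite (_ : Ordinal _ = 0)//; apply/val_inj.
- by rewrite (_ : Ordinal _ = 1)//; apply/val_inj.
- by rewrite (_ : Ordinal _ = @Ordinal 3 2 isT)//; apply/val_inj.
Qed.

Lemma has_int_gauss3 : has_int (@leb3 R) gauss3 1.
Proof.
apply: (has_int_eq (@has_int_gauss3_monom 0 0 0 isT isT isT)) => [p|].
  by rewrite !expr0 !mul1r.
by rewrite /= !mul1r.
Qed.

Lemma has_int_gauss3_1 i : has_int (@leb3 R) (fun p => vec3 p i 0 * gauss3 p) 0.
Proof.
move: i; apply: ord3P.
- apply: (has_int_eq (@has_int_gauss3_monom 1 0 0 isT isT isT)) => [p|];
  by rewrite ?vec3E ?expr0 ?expr1 ?mul1r ?mulr1 /= ?mul0r ?mulr0 ?mul0r.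
- apply: (has_int_eq (@has_int_gauss3_monom 0 1 0 isT isT isT)) => [p|];
  by rewrite ?vec3E ?expr0 ?expr1 ?mul1r ?mulr1 /= ?mul0r ?mulr0 ?mul0r.
- apply: (has_int_eq (@has_int_gauss3_monom 0 0 1 isT isT isT)) => [p|];
  by rewrite ?vec3E ?expr0 ?expr1 ?mul1r ?mulr1 /= ?mul0r ?mulr0 ?mul0r.
Qed.

Lemma has_int_gauss3_2 i j :
  has_int (@leb3 R) (fun p => vec3 p i 0 * vec3 p j 0 * gauss3 p) (i == j)%:R.
Proof.
(* e k is the exponent of the k-th coordinate in the monomial. *)
pose e k := ((i == k) + (j == k))%N.
have e2 k : (e k <= 2)%N by rewrite /e; case: (i == k); case: (j == k).
apply: (has_int_eq (has_int_gauss3_monom (e2 0) (e2 1) (e2 (@Ordinal 3 2 isT)))).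
  move=> p; rewrite /e {e e2}; move: i j; apply: ord3P; apply: ord3P;
  by rewrite ?vec3E /=; ring.
rewrite /e {e e2}; move: i j; apply: ord3P; apply: ord3P => /=; ring.
Qed.

End gauss3.

Section gauss6.
Context {R : realType}.
Implicit Types (q : mR3 R * mR3 R) (u w : 'I_3 -> R).

Definition gauss6 q : R := gauss3 q.1 * gauss3 q.2.

Lemma has_int_tensor6 (f g : mR3 R -> R) (c e : R) :
  has_int (@leb3 R) f c -> has_int (@leb3 R) g e ->
  has_int (@leb6 R) (fun q => f q.1 * g q.2) (c * e).
Proof. by move=> hf hg; exact: (has_int_tensor hf hg). Qed.

(** An affine form in the six coordinates; u and w are its linear parts in
    position and velocity. *)
Definition aff (l : R) u w q : R :=
  l + \sum_k (u k * vec3 q.1 k 0 + w k * vec3 q.2 k 0).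

Lemma has_int_gauss6 : has_int (@leb6 R) gauss6 1.
Proof.
by apply: (has_int_eq (has_int_tensor6 has_int_gauss3 has_int_gauss3)); rewrite ?mulr1.
Qed.

Lemma has_int_affM (B : mR3 R * mR3 R -> R) (e : R) (eu ew : 'I_3 -> R) l u w :
  has_int (@leb6 R) (fun q => B q * gauss6 q) e ->
  (forall k, has_int (@leb6 R) (fun q => vec3 q.1 k 0 * (B q * gauss6 q)) (eu k)) ->
  (forall k, has_int (@leb6 R) (fun q => vec3 q.2 k 0 * (B q * gauss6 q)) (ew k)) ->
  has_int (@leb6 R) (fun q => aff l u w q * (B q * gauss6 q))
    (l * e + \sum_k (u k * eu k + w k * ew k)).
Proof.
move=> hB hu hw.
have h := has_intD (has_intZ l hB) (has_int_sum (index_enum _) predT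
  (fun k => has_intD (has_intZ (u k) (hu k)) (has_intZ (w k) (hw k)))).
apply: (has_int_eq h) => // q; rewrite /aff mulrDl; congr (_ + _).
by rewrite mulr_suml; apply: eq_bigr => k _; ring.
Qed.

Lemma has_int_aff l u w :
  has_int (@leb6 R) (fun q => aff l u w q * gauss6 q) l.
Proof.
apply: (has_int_eq (@has_int_affM (fun=> 1) 1 (fun=> 0) (fun=> 0) l u w _ _ _)).
- by apply: (has_int_eq has_int_gauss6) => // q; rewrite mul1r.
- move=> k; apply: (has_int_eq
    (has_int_tensor6 (has_int_gauss3_1 k) has_int_gauss3)) => [q|];
      last by rewrite mul0r.
  by rewrite /gauss6; ring.
- move=> k; apply: (has_int_eq
    (has_int_tensor6 has_int_gauss3 (has_int_gauss3_1 k))) => [q|];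
      last by rewrite mulr0.
  by rewrite /gauss6; ring.
- by move=> q; rewrite mul1r.
- by rewrite big1 ?addr0 ?mulr1// => k _; rewrite !mulr0 addr0.
Qed.

Lemma has_int_aff_x l u w k :
  has_int (@leb6 R) (fun q => aff l u w q * (vec3 q.1 k 0 * gauss6 q)) (u k).
Proof.
apply: (has_int_eq (@has_int_affM (fun q => vec3 q.1 k 0) 0
  (fun j => (j == k)%:R) (fun=> 0) l u w _ _ _)) => //.
- by apply: (has_int_eq (has_int_tensor6 (has_int_gauss3_1 k) has_int_gauss3)) => [q|];
    [rewrite /gauss6; ring|rewrite mul0r].
- move=> j; apply: (has_int_eq
    (has_int_tensor6 (has_int_gauss3_2 j k) has_int_gauss3)) => [q|];
      last by rewrite mulr1.
  by rewrite /gauss6; ring.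
- move=> j; apply: (has_int_eq
    (has_int_tensor6 (has_int_gauss3_1 k) (has_int_gauss3_1 j))) => [q|];
      last by rewrite mulr0.
  by rewrite /gauss6; ring.
- rewrite mulr0 add0r (bigD1 k)//= big1 => [|j /negbTE ->].
    by rewrite eqxx mulr1 !mulr0 ?addr0 ?add0r.
  by rewrite !mulr0 addr0.
Qed.

Lemma has_int_aff_v l u w k :
  has_int (@leb6 R) (fun q => aff l u w q * (vec3 q.2 k 0 * gauss6 q)) (w k).
Proof.
apply: (has_int_eq (@has_int_affM (fun q => vec3 q.2 k 0) 0
  (fun=> 0) (fun j => (j == k)%:R) l u w _ _ _)) => //.
- by apply: (has_int_eq (has_int_tensor6 has_int_gauss3 (has_int_gauss3_1 k))) => [q|];
    [rewrite /gauss6; ring|rewrite mulr0].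
- move=> j; apply: (has_int_eq
    (has_int_tensor6 (has_int_gauss3_1 j) (has_int_gauss3_1 k))) => [q|];
      last by rewrite mulr0.
  by rewrite /gauss6; ring.
- move=> j; apply: (has_int_eq
    (has_int_tensor6 has_int_gauss3 (has_int_gauss3_2 j k))) => [q|];
      last by rewrite mul1r.
  by rewrite /gauss6; ring.
- rewrite mulr0 add0r (bigD1 k)//= big1 => [|j /negbTE ->].
    by rewrite eqxx mulr1 !mulr0 ?addr0 ?add0r.
  by rewrite !mulr0 addr0.
Qed.

(** The coordinates are centred, of unit variance and uncorrelated. *)
Lemma has_int_aff2 l u w l' u' w' :
  has_int (@leb6 R) (fun q => aff l u w q * aff l' u' w' q * gauss6 q)
    (l * l' + \sum_k (u k * u' k + w k * w' k)).
Proof.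
apply: (has_int_eq (@has_int_affM (aff l' u' w') l' u' w' l u w _ _ _)) => //.
- exact: has_int_aff.
- by move=> k; apply: (has_int_eq (has_int_aff_x l' u' w' k)) => //= q; rewrite mulrCA.
- by move=> k; apply: (has_int_eq (has_int_aff_v l' u' w' k)) => //= q; rewrite mulrCA.
- by move=> q; rewrite mulrA.
Qed.

End gauss6.

Section triangular.
Context {R : realType}.

(** The map p -> U p + y on triples, with the entries above the diagonal of U
    ignored, so that each coordinate depends only on the preceding ones. *)
Definition tri3 (U : 'M[R]_3) (y : 'cV[R]_3) (p : mR3 R) : mR3 R :=
  ((U 0 0 * p.1.1 + y 0 0, U 1 1 * p.1.2 + (U 1 0 * p.1.1 + y 1 0)),
   U o2 o2 * p.2 + (U o2 0 * p.1.1 + U o2 1 * p.1.2 + y o2 0)).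

Definition lower3 (U : 'M[R]_3) := [/\ U 0 1 = 0, U 0 o2 = 0 & U 1 o2 = 0].

Lemma sum3 (f : 'I_3 -> R) : \sum_i f i = f 0 + f 1 + f o2.
Proof.
rewrite !big_ord_recl big_ord0 addr0 addrA.
by congr (f _ + f _ + f _); exact/val_inj.
Qed.

Lemma vec3_tri3 (U : 'M[R]_3) (y : 'cV[R]_3) p : lower3 U ->
  vec3 (tri3 U y p) = y + U *m vec3 p.
Proof.
move=> [U01 U02 U12]; apply/matrixP => i j; rewrite (ord1 j) {j}.
move: i; apply: ord3P; rewrite !mxE sum3 !mxE /= ?U01 ?U02 ?U12; ring.
Qed.

Lemma scales_tri3 (U : 'M[R]_3) (y : 'cV[R]_3) : U 0 0 != 0 -> U 1 1 != 0 ->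
  U o2 o2 != 0 ->
  scales (@leb3 R) (tri3 U y) (`|U 0 0|^-1 * `|U 1 1|^-1 * `|U o2 o2|^-1).
Proof.
move=> U0 U1 U2.
have m1 : measurable_fun [set: mR3 R] (fun p => p.1.1).
  exact: (measurableT_comp measurable_fst measurable_fst).
have m2 : measurable_fun [set: mR3 R] (fun p => p.1.2).
  exact: (measurableT_comp measurable_snd measurable_fst).
have s2 : scales (@leb2 R) (fun p => (U 0 0 * p.1 + y 0 0,
    U 1 1 * p.2 + (U 1 0 * p.1 + y 1 0))) (`|U 0 0|^-1 * `|U 1 1|^-1).
  apply: (scales_fibered (scales_affine (y 0 0) U0)
    (fun x1 => scales_affine (U 1 0 * x1 + y 1 0) U1)).
  apply: measurable_funD; first exact: measurable_funM.
  by apply: measurable_funD => //; exact: measurable_funM.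
apply: (scales_fibered s2
  (fun p => scales_affine (U o2 0 * p.1 + U o2 1 * p.2 + y o2 0) U2)).
apply: measurable_funD; first exact: measurable_funM.
apply: measurable_funD => //; apply: measurable_funD => //; exact: measurable_funM.
Qed.

End triangular.

(** * First and second moments of a density on phase space *)

Section moments.
Context {R : realType}.
Implicit Types (F : 'cV[R]_3 -> 'cV[R]_3 -> R) (x v y z : 'cV[R]_3) (t : R).

(** All moments of degree at most two.  The full matrices are kept, although
    only traces and an antisymmetric part are conserved, because the matrices
    are what transforms linearly. *)
Definition has_moments F (m : R) y z (Mxx Mxv Mvv : 'M[R]_3) : Prop :=
  [/\ has_int (@leb6 R) (on6 F) m,
      (forall i, has_int (@leb6 R) (on6 (fun x v => F x v * x i 0)) (y i 0)) /\
      (forall i, has_int (@leb6 R) (on6 (fun x v => F x v * v i 0)) (z i 0)),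
      forall i j, has_int (@leb6 R)
        (on6 (fun x v => F x v * (x i 0 * x j 0))) (Mxx i j),
      forall i j, has_int (@leb6 R)
        (on6 (fun x v => F x v * (x i 0 * v j 0))) (Mxv i j)
    & forall i j, has_int (@leb6 R)
        (on6 (fun x v => F x v * (v i 0 * v j 0))) (Mvv i j)].

Lemma measurable_vec3 i : measurable_fun [set: mR3 R] (fun p => vec3 p i 0).
Proof.
move: i; apply: ord3P.
- have -> : (fun p : mR3 R => vec3 p 0 0) = (fun p => p.1.1).
    by apply/funext => p; rewrite vec3E.
  exact: (measurableT_comp measurable_fst measurable_fst).
- have -> : (fun p : mR3 R => vec3 p 1 0) = (fun p => p.1.2).
    by apply/funext => p; rewrite vec3E.
  exact: (measurableT_comp measurable_snd measurable_fst).
- have -> : (fun p : mR3 R => vec3 p o2 0) = (fun p => p.2).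
    by apply/funext => p; rewrite vec3E.
  exact: measurable_snd.
Qed.

Lemma measurable_lin d (T : measurableType d) (k : R) (f : T -> R) :
  measurable_fun setT f -> measurable_fun setT (fun e => k * f e).
Proof. by move=> mf; exact: measurable_funM. Qed.

Lemma measurable_affine d (T : measurableType d) (k : R) (f g : T -> R) :
  measurable_fun setT f -> measurable_fun setT g ->
  measurable_fun setT (fun e => k * f e + g e).
Proof. by move=> mf mg; exact: (measurable_funD (measurable_lin k mf) mg). Qed.

Lemma measurable_triple d (T : measurableType d) (f g h : T -> R) :
  measurable_fun setT f -> measurable_fun setT g -> measurable_fun setT h ->
  measurable_fun setT (fun e => (f e, g e, h e) : mR3 R).
Proof.
move=> mf mg mh; apply: measurable_fun_pair => //; exact: measurable_fun_pair.
Qed.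

Lemma measurable_on6_x i :
  measurable_fun [set: mR3 R * mR3 R] (on6 (fun x _ => x i 0)).
Proof. exact: (measurableT_comp (measurable_vec3 i) measurable_fst). Qed.

Lemma measurable_on6_v i :
  measurable_fun [set: mR3 R * mR3 R] (on6 (fun _ v => v i 0)).
Proof. exact: (measurableT_comp (measurable_vec3 i) measurable_snd). Qed.

(** If F becomes N times the standard Gaussian in the variables xi, eta with
    x = y + U xi and v = z + K xi + s eta, its moments are read off from those
    variables.  The map is triangular, with determinant the product of the
    diagonal of U times s ^+ 3. *)
Lemma gaussian_has_moments F (N : R) (U K : 'M[R]_3) (s : R) y z :
  measurable_fun setT (on6 F) -> lower3 U ->
  0 < U 0 0 -> 0 < U 1 1 -> 0 < U o2 o2 -> 0 < s ->
  (forall q : mR3 R * mR3 R,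
     F (y + U *m vec3 q.1) (z + K *m vec3 q.1 + s *: vec3 q.2) = N * gauss6 q) ->
  let m := U 0 0 * U 1 1 * U o2 o2 * s ^+ 3 * N in
  has_moments F m (m *: y) (m *: z) (m *: (y *m y^T + U *m U^T))
    (m *: (y *m z^T + U *m K^T)) (m *: (z *m z^T + K *m K^T + (s ^+ 2)%:M)).
Proof.
move=> mF lU U0 U1 U2 s0 FE m.
(* th is triangular: the position first, then the velocity given the position. *)
pose th (q : mR3 R * mR3 R) :=
  (tri3 U y q.1, tri3 s%:M (z + K *m vec3 q.1) q.2).
have lS : lower3 (s%:M : 'M[R]_3) by split; rewrite mxE.
have sth : scales (@leb6 R) th (`|U 0 0|^-1 * `|U 1 1|^-1 * `|U o2 o2|^-1 *
                                (`|s|^-1 * `|s|^-1 * `|s|^-1)).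
  apply: (@scales_fibered _ _ _ _ _ (@leb3 R) (@leb3 R) (tri3 U y)
     (fun p => tri3 s%:M (z + K *m vec3 p))).
  - by apply: scales_tri3; rewrite gt_eqF.
  - move=> p; have := @scales_tri3 R s%:M (z + K *m vec3 p).
    by rewrite !mxE /= !mulr1n => H; apply: H; rewrite gt_eqF.
  - have mK i : measurable_fun [set: mR3 R * mR3 R]
       (fun q => (z + K *m vec3 q.1) i 0).
      have -> : (fun q : mR3 R * mR3 R => (z + K *m vec3 q.1) i 0) =
        (fun q => z i 0 + (K i 0 * vec3 q.1 0 0 + K i 1 * vec3 q.1 1 0 +
           K i o2 * vec3 q.1 o2 0)).
        by apply/funext => q; rewrite 2!mxE sum3.
      have mx := measurable_on6_x.
      exact: (measurable_funD (measurable_cst _) (measurable_funD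
        (measurable_affine _ (mx 0) (measurable_lin _ (mx 1)))
        (measurable_lin _ (mx o2)))).
    have m1 : measurable_fun [set: mR3 R * mR3 R] (fun q => q.2.1.1 : R).
      rewrite (_ : (fun q => q.2.1.1 : R) = on6 (fun _ v => v 0 0)); last first.
        by apply/funext => q; rewrite /on6 vec3E.
      exact: measurable_on6_v.
    have m2 : measurable_fun [set: mR3 R * mR3 R] (fun q => q.2.1.2 : R).
      rewrite (_ : (fun q => q.2.1.2 : R) = on6 (fun _ v => v 1 0)); last first.
        by apply/funext => q; rewrite /on6 vec3E.
      exact: measurable_on6_v.
    have m3 : measurable_fun [set: mR3 R * mR3 R] (fun q => q.2.2 : R).
      rewrite (_ : (fun q => q.2.2 : R) = on6 (fun _ v => v o2 0)); last first.
        by apply/funext => q; rewrite /on6 vec3E.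
      exact: measurable_on6_v.
    exact: (measurable_triple (measurable_affine _ m1 (mK 0))
      (measurable_affine _ m2 (measurable_affine _ m1 (mK 1)))
      (measurable_affine _ m3 (measurable_funD
        (measurable_affine _ m1 (measurable_lin _ m2)) (mK o2)))).
rewrite !gtr0_norm// in sth.
have xE q : vec3 (th q).1 = y + U *m vec3 q.1 by exact: vec3_tri3.
have vE q : vec3 (th q).2 = z + K *m vec3 q.1 + s *: vec3 q.2.
  by rewrite vec3_tri3// mul_scalar_mx.
have key (g : 'cV[R]_3 -> 'cV[R]_3 -> R) (c : R) :
    measurable_fun setT (on6 g) ->
    has_int (@leb6 R) (fun q => g (vec3 (th q).1) (vec3 (th q).2) * gauss6 q) c ->
    has_int (@leb6 R) (on6 (fun x v => F x v * g x v)) (m * c).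
  move=> mg hg.
  have h := @has_int_scales _ _ _ _ th _ (on6 (fun x v => F x v * g x v)) (N * c) sth.
  apply: (has_int_eq (h _ _)) => //.
  - exact: (measurable_funM mF mg).
  - apply: (has_int_eq (has_intZ N hg)) => // q.
    by rewrite /on6 /= [in RHS]xE [in RHS]vE FE -xE -vE; ring.
  - by rewrite /m; field; rewrite !gt_eqF.
have xA i q : vec3 (th q).1 i 0 = aff (y i 0) (fun k => U i k) (fun=> 0) q.
  rewrite xE !mxE /aff; congr (_ + _); apply: eq_bigr => k _.
  by rewrite mul0r addr0.
have vA i q : vec3 (th q).2 i 0 =
    aff (z i 0) (fun k => K i k) (fun k => s * (i == k)%:R) q.
  rewrite vE !mxE /aff -addrA; congr (_ + _).
  rewrite big_split/=; congr (_ + _).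
  rewrite (bigD1 i)//= eqxx mulr1 big1 ?addr0 => [|k /negbTE]; first by rewrite mxE.
  by rewrite eq_sym => ->; rewrite mulr0 mul0r.
split.
- apply: (has_int_eq (@key (fun _ _ => 1) 1 _ _)).
  + exact: measurable_cst.
  + by apply: (has_int_eq has_int_gauss6) => // q; rewrite mul1r.
  + by move=> q; rewrite /on6 mulr1.
  + by rewrite mulr1.
- split=> i; rewrite mxE; apply: key.
  + exact: measurable_on6_x.
  + by apply: (has_int_eq (has_int_aff _ _ _)) => // q; rewrite xA.
  + exact: measurable_on6_v.
  + by apply: (has_int_eq (has_int_aff _ _ _)) => // q; rewrite vA.
- move=> i j; rewrite mxE; apply: key.
    by apply: measurable_funM; exact: measurable_on6_x.
  apply: (has_int_eq (has_int_aff2 _ _ _ _ _ _)) => [q|]; first by rewrite !xA.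
  rewrite !mxE big_ord1 !mxE; congr (_ + _); apply: eq_bigr => k _.
  by rewrite mxE mulr0 addr0.
- move=> i j; rewrite mxE; apply: key.
    by apply: measurable_funM; [exact: measurable_on6_x|exact: measurable_on6_v].
  apply: (has_int_eq (has_int_aff2 _ _ _ _ _ _)) => [q|]; first by rewrite xA vA.
  rewrite !mxE big_ord1 !mxE; congr (_ + _); apply: eq_bigr => k _.
  by rewrite mxE mul0r addr0.
- move=> i j; rewrite mxE; apply: key.
    by apply: measurable_funM; exact: measurable_on6_v.
  apply: (has_int_eq (has_int_aff2 _ _ _ _ _ _)) => [q|]; first by rewrite !vA.
  rewrite !mxE big_ord1 !mxE -addrA; congr (_ + _).
  rewrite big_split/=; congr (_ + _); first by apply: eq_bigr => k _; rewrite mxE.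
  rewrite (bigD1 i)//= eqxx mulr1 big1 ?addr0 => [|k /negbTE].
    by rewrite mulrA -expr2 eq_sym mulr_natr.
  by rewrite eq_sym => ->; rewrite mulr0 mul0r.
Qed.

End moments.

(** * Skew-symmetric 3 x 3 matrices *)

Ltac mx3 := apply/matrixP; apply: ord3P; apply: ord3P;
  rewrite ?(mxE, sum3) /=.

Section skew.
Context {R : realType}.
Implicit Types (A : 'M[R]_3) (D : R).

(** The squared length of the axial vector r of A, that is, the vector with
    A u = r x u; for skew A the eigenvalues of A ^ 2 are 0, - axsq A, - axsq A. *)
Definition axsq A : R := A 1 0 ^+ 2 + A o2 0 ^+ 2 + A o2 1 ^+ 2.

Lemma axsq_ge0 A : 0 <= axsq A.
Proof. by rewrite !addr_ge0 ?sqr_ge0. Qed.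

Lemma skewE A : A^T = - A ->
  (A 0 0 = 0) * (A 1 1 = 0) * (A o2 o2 = 0) *
  (A 0 1 = - A 1 0) * (A 0 o2 = - A o2 0) * (A 1 o2 = - A o2 1).
Proof.
move=> sA; have E i j : A i j = - A j i.
  by have := congr1 (fun M : 'M[R]_3 => M j i) sA; rewrite !mxE.
have Z i : A i i = 0 by have := E i i; lra.
by rewrite !Z (E 0 1) (E 0 o2) (E 1 o2).
Qed.

Lemma skew_cube A : A^T = - A -> A *m A *m A = (- axsq A) *: A.
Proof. by move=> /skewE sA; mx3; rewrite !sA /axsq; ring. Qed.

Lemma skew_sqr_tr A : A^T = - A -> \tr (A *m A) = - 2 * axsq A.
Proof. by move=> /skewE sA; rewrite /mxtrace sum3 !(mxE, sum3) !sA /axsq; ring. Qed.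

Lemma det3 A : \det A = A 0 0 * (A 1 1 * A o2 o2 - A 1 o2 * A o2 1)
  - A 0 1 * (A 1 0 * A o2 o2 - A 1 o2 * A o2 0)
  + A 0 o2 * (A 1 0 * A o2 1 - A 1 1 * A o2 0).
Proof.
have det2 (B : 'M[R]_2) : \det B = B 0 0 * B 1 1 - B 0 1 * B 1 0.
  rewrite (expand_det_row _ 0) !big_ord_recl big_ord0 /cofactor !det_mx11 !mxE /=.
  have -> : lift 0 0 = 1 :> 'I_2 by apply/val_inj.
  have -> : lift 1 0 = 0 :> 'I_2 by apply/val_inj.
  ring.
have l00 : lift 0 0 = 1 :> 'I_3 by apply/val_inj.
have l01 : lift 0 1 = o2 :> 'I_3 by apply/val_inj.
have l10 : lift 1 0 = 0 :> 'I_3 by apply/val_inj.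
have l11 : lift 1 1 = o2 :> 'I_3 by apply/val_inj.
have l20 : lift o2 0 = 0 :> 'I_3 by apply/val_inj.
have l21 : lift o2 1 = 1 :> 'I_3 by apply/val_inj.
rewrite (expand_det_row _ 0) sum3 /cofactor !det2 !mxE /= ?l00 ?l01 ?l10 ?l11 ?l20 ?l21.
ring.
Qed.

Lemma dotE (u w : 'cV[R]_3) : dot u w = (u^T *m w) 0 0.
Proof. by rewrite /dot mxE; apply: eq_bigr => i _; rewrite mxE. Qed.

Lemma sqn_ge0 (u : 'cV[R]_3) : 0 <= sqn u.
Proof. by rewrite sumr_ge0// => i _; rewrite -expr2 sqr_ge0. Qed.

Lemma sqn_eq0 (u : 'cV[R]_3) : sqn u = 0 -> u = 0.
Proof.
move/eqP; rewrite psumr_eq0 => [/allP u0|i _]; last by rewrite -expr2 sqr_ge0.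
apply/matrixP => i j; rewrite (ord1 j) mxE.
by have := u0 i (mem_index_enum _); rewrite mulf_eq0 orbb => /eqP.
Qed.

Lemma gram_eq0 (M : 'M[R]_3) : M^T *m M = 0 -> M = 0.
Proof.
move=> M0; apply/matrixP => i j; rewrite mxE.
have /sqn_eq0/matrixP/(_ i 0) : sqn (col j M) = 0; last by rewrite !mxE.
have := congr1 (fun B : 'M[R]_3 => B j j) M0; rewrite !mxE => E; rewrite -[RHS]E.
by apply: eq_bigr => k _; rewrite !mxE.
Qed.

(** S + k is injective on vectors because S is positive, and
    (S + k) S ^ 2 (S - k) = N ^ 2 - k ^ 2 N = 0; hence S ^ 2 (S - k) = 0, so the
    symmetric matrix S (S - k) has square zero and vanishes. *)
Lemma psd_sqrt_unique (S : 'M[R]_3) (N : 'M[R]_3) (k : R) :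
  psd S -> S *m S = N -> N *m N = k ^+ 2 *: N -> 0 < k -> k *: S = N.
Proof.
move=> [symS posS] SS NN k0.
have inj (M : 'M[R]_3) : (S + k%:M) *m M = 0 -> M = 0.
  move=> SM; apply/matrixP => i j; rewrite mxE.
  have E : dot (col j M) (S *m col j M) + k * sqn (col j M) = 0.
    have := congr1 (fun B : 'M[R]_3 => (M^T *m B) j j) SM.
    rewrite mulmx0 [RHS]mxE mulmxDl mul_scalar_mx mulmxDr -scalemxAr.
    rewrite mxE [X in _ + X]mxE => E; rewrite -[RHS]E; congr (_ + _ * _).
      rewrite /dot mxE; apply: eq_bigr => l _; rewrite !mxE; congr (_ * _).
      by apply: eq_bigr => i' _; rewrite mxE.
    by rewrite /sqn /dot mxE; apply: eq_bigr => l _; rewrite !mxE.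
  have := posS (col j M); have := sqn_ge0 (col j M) => s0 p0.
  have /sqn_eq0/matrixP/(_ i 0) : sqn (col j M) = 0 by nra.
  by rewrite !mxE.
have S2 : N *m (S - k%:M) = 0.
  apply: inj; rewrite -SS.
  have -> : (S + k%:M) *m (S *m S *m (S - k%:M)) =
            (S *m S) *m (S *m S) - k ^+ 2 *: (S *m S).
    rewrite !mulmxDl !mulmxDr !mulmxN !mul_scalar_mx !mul_mx_scalar.
    rewrite !mulmxA -!scalemxAr -?scalemxAl scalerA -expr2 -!mulmxA.
    by rewrite addrA subrK.
  by rewrite SS NN subrr.
(* N - k S = S (S - k) is symmetric, so it vanishes when its square does. *)
have T0 : N - k *: S = 0.
  have symN : N^T = N by rewrite -SS trmx_mul symS.
  apply: gram_eq0.
  have -> : (N - k *: S)^T = N - k *: S.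
    by rewrite -[in RHS]symS -[in RHS]symN; apply/matrixP => i j; rewrite !mxE.
  have -> : N - k *: S = S *m (S - k%:M).
    by rewrite mulmxBr mul_mx_scalar SS.
  rewrite mulmxA; have -> : S *m (S - k%:M) *m S = N *m (S - k%:M).
    by rewrite -SS mulmxBr mulmxBl mulmxBr mul_mx_scalar -scalemxAl ?mul_mx_scalar.
  by rewrite S2 mul0mx.
by move/eqP: T0; rewrite subr_eq0 => /eqP.
Qed.

(** A^T A is the square of the axial length times a projection of rank two, so
    its square root has the axial length as a double eigenvalue. *)
Lemma tr_absmx A : A^T = - A -> \tr (absmx A) = 2 * Num.sqrt (axsq A).
Proof.
move=> sA; set r := Num.sqrt _.
have r2 : r ^+ 2 = axsq A by rewrite sqr_sqrtr// axsq_ge0.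
have r_ge0 : 0 <= r by exact: sqrtr_ge0.
pose N := A^T *m A.
have NE : N = - (A *m A) by rewrite /N sA mulNmx.
have NN : N *m N = r ^+ 2 *: N.
  rewrite NE mulmxN mulNmx opprK mulmxA skew_cube// -scalemxAl r2.
  by rewrite scaleNr scalerN.
have trN : \tr N = 2 * r ^+ 2 by rewrite NE raddfN/= skew_sqr_tr// r2; ring.
have psdN : psd N.
  split; first by rewrite /N trmx_mul trmxK.
  move=> u; have -> : dot u (N *m u) = sqn (A *m u).
    by rewrite /sqn !dotE trmx_mul /N !mulmxA.
  exact: sqn_ge0.
have [] : [set S | psd S /\ S *m S = A^T *m A] (absmx A).
  rewrite /absmx; apply: xgetPex; have [r0|rn0] := eqVneq r 0.
    exists 0; split; first by split=> [|u];
      [rewrite trmx0|rewrite mul0mx dotE mulmx0 mxE].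
    have N0 : N^T *m N = 0 by rewrite psdN.1 NN r0 expr0n scale0r.
    by rewrite mulmx0 -/N (gram_eq0 N0).
  exists (r^-1 *: N); split; last first.
    rewrite -scalemxAl -scalemxAr NN !scalerA -/N.
    by rewrite (_ : _ * _ = 1) ?scale1r//; field.
  split=> [|u]; first by rewrite linearZ/= psdN.1.
  rewrite -scalemxAl dotE -scalemxAr mxE -dotE mulr_ge0 ?invr_ge0//.
  exact: psdN.2.
set S := absmx A => psdS SS.
have [r0|rn0] := eqVneq r 0.
  have N0 : N^T *m N = 0 by rewrite psdN.1 NN r0 expr0n scale0r.
  have S0 : S = 0 by apply: gram_eq0; rewrite psdS.1 SS -/N (gram_eq0 N0).
  by rewrite S0 mxtrace0 r0 mulr0.
have r_gt0 : 0 < r by rewrite lt_def rn0.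
have /(congr1 mxtrace) := psd_sqrt_unique psdS SS NN r_gt0.
rewrite mxtraceZ trN expr2 mulrCA => /(mulfI rn0).
by [].
Qed.

(** The trace condition says that the axial length of A is below the square
    root of a c - b ^ 2, which is positivity of the quadratic form in the
    exponent. *)
Lemma calOE (a b c : R) A : calO a b c A <->
  [/\ 0 < a, 0 < c, A^T = - A & axsq A < a * c - b ^+ 2].
Proof.
have q0 := axsq_ge0 A.
split=> [[a0 c0 D0 sA]|[a0 c0 sA lt]].
  rewrite tr_absmx// ltr_pM2l// ltr_sqrt// => lt.
  have b2 := sqr_ge0 b; split=> //; rewrite lt_def ?a0 ?c0 andbT.
    by apply/eqP => a00; move: D0; rewrite a00; nra.
  by apply/eqP => c00; move: D0; rewrite c00; nra.
have D0 : 0 < a * c - b ^+ 2 by lra.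
split => //; try exact: ltW.
by rewrite tr_absmx// ltr_pM2l// ltr_sqrt.
Qed.

Lemma det_Q A D : A^T = - A -> \det (D%:M + A *m A) = D * (D - axsq A) ^+ 2.
Proof.
move=> /skewE sA; rewrite det3 !(mxE, sum3) /= !sA /axsq; ring.
Qed.

(** The inverse of Q = D + A ^ 2: since A ^ 4 is - axsq A times A ^ 2, the
    geometric series for the inverse collapses to a multiple of A ^ 2. *)
Definition covmx A D : 'M[R]_3 := D^-1 *: (1%:M - (D - axsq A)^-1 *: (A *m A)).

Lemma Q_covmx A D : A^T = - A -> 0 < D -> axsq A < D ->
  (D%:M + A *m A) *m covmx A D = 1%:M.
Proof.
move=> sA D0 lt; have e0 : D - axsq A != 0 by rewrite gt_eqF// subr_gt0.
have c4 : A *m A *m (A *m A) = - axsq A *: (A *m A).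
  by rewrite mulmxA skew_cube// -scalemxAl.
rewrite /covmx -scalemxAr mulmxBr mulmx1 -scalemxAr mulmxDl c4 mul_scalar_mx.
rewrite -scalerDl scalerA (addrC D) mulVf ?scale1r ?addrK; last first.
  by rewrite addrC.
by rewrite scale_scalar_mx mulVf ?scale1r// gt_eqF.
Qed.

Lemma covmx_comm A D : A *m covmx A D = covmx A D *m A.
Proof.
by rewrite /covmx -scalemxAr -scalemxAl mulmxBr mulmxBl mulmx1 mul1mx
  -scalemxAr -scalemxAl mulmxA.
Qed.

Lemma skew_covmx A D : A^T = - A -> 0 < D -> axsq A < D ->
  A *m covmx A D = (D - axsq A)^-1 *: A.
Proof.
move=> sA D0 lt; have e0 : D - axsq A != 0 by rewrite gt_eqF// subr_gt0.
rewrite /covmx -scalemxAr mulmxBr mulmx1 -scalemxAr mulmxA skew_cube//.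
rewrite scalerA -[X in X - _]scale1r -scalerBl scalerA; congr (_ *: _).
by field; rewrite e0 gt_eqF.
Qed.

Lemma tr_covmx A D : A^T = - A -> 0 < D -> axsq A < D ->
  \tr (covmx A D) = D^-1 + 2 / (D - axsq A).
Proof.
move=> sA D0 lt; have e0 : D - axsq A != 0 by rewrite gt_eqF// subr_gt0.
rewrite /covmx mxtraceZ raddfB/= mxtrace1 mxtraceZ skew_sqr_tr//.
by field; rewrite e0 gt_eqF.
Qed.

End skew.

(** * Triangular factorization of the precision matrix *)

Section maxwell0.
Context {R : realType}.
Implicit Types (A U : 'M[R]_3) (D c : R).

(** With r the axial vector, Q = (D - axsq A) + r r^T, and completing the square
    first in the third coordinate, then in the second, diagonalizes it
    explicitly. *)
Lemma cholesky_Q A D c : A^T = - A -> axsq A < D -> 0 < c ->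
  exists U : 'M[R]_3, [/\ lower3 U, 0 < U 0 0, 0 < U 1 1, 0 < U o2 o2
    & U^T *m (D%:M + A *m A) *m U = c%:M].
Proof.
move=> sA0 lt c0; have sA := skewE sA0.
pose r1 := A o2 1; pose r2 := - A o2 0; pose r3 := A 1 0.
pose e := D - axsq A.
have e0 : 0 < e by rewrite subr_gt0.
(* The pivots, from the last coordinate to the first, are g3, e g2 / g3 and
   e g1 / g2; note that g1 = D. *)
pose g3 := e + r3 ^+ 2; pose g2 := g3 + r2 ^+ 2; pose g1 := g2 + r1 ^+ 2.
have g3_gt0 : 0 < g3 by rewrite ltr_wpDr ?sqr_ge0.
have g2_gt0 : 0 < g2 by rewrite ltr_wpDr ?sqr_ge0.
have g1_gt0 : 0 < g1 by rewrite ltr_wpDr ?sqr_ge0.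
have QE : D%:M + A *m A = e%:M + \matrix_(i, j)
    ([:: r1; r2; r3]`_i * [:: r1; r2; r3]`_j).
  by mx3; rewrite !sA /e /axsq /r1 /r2 /r3; ring.
pose V : 'M[R]_3 := \matrix_(i, j) nth 0 (nth [::]
  [:: [:: 1; 0; 0]; [:: - (r1 * r2 / g2); 1; 0];
      [:: - (r3 * r1 / g2); - (r3 * r2 / g3); 1]] i) j.
pose d : 'rV[R]_3 := \row_i [:: e * g1 / g2; e * g2 / g3; g3]`_i.
have ne : (e != 0) * (g1 != 0) * (g2 != 0) * (g3 != 0) by rewrite !gt_eqF.
have VQV : V^T *m (D%:M + A *m A) *m V = diag_mx d.
  have n3 : e + r3 ^+ 2 != 0 by rewrite gt_eqF.
  have n2 : e + r3 ^+ 2 + r2 ^+ 2 != 0 by rewrite gt_eqF.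
  rewrite QE /V /d /g1 /g2 /g3; clearbody e r1 r2 r3; clear -n3 n2.
  by mx3; field; rewrite ?n3 ?n2.
pose w : 'rV[R]_3 := \row_i [:: Num.sqrt (c * g2 / (e * g1));
  Num.sqrt (c * g3 / (e * g2)); Num.sqrt (c / g3)]`_i.
have w_gt0 i : 0 < w 0 i.
  by move: i; apply: ord3P; rewrite mxE /= sqrtr_gt0 ?divr_gt0 ?mulr_gt0.
exists (V *m diag_mx w); have E i j : (V *m diag_mx w) i j = V i j * w 0 j.
  by rewrite mul_mx_diag mxE.
have V1 i : V i i = 1 by move: i; apply: ord3P; rewrite mxE.
rewrite /lower3 !E !V1 !mul1r; split; [|exact: w_gt0..|].
  by split; rewrite mxE /= mul0r.
have -> : (V *m diag_mx w)^T *m (D%:M + A *m A) *m (V *m diag_mx w) =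
    diag_mx w *m (V^T *m (D%:M + A *m A) *m V) *m diag_mx w.
  by rewrite trmx_mul tr_diag_mx !mulmxA.
rewrite VQV !mulmx_diag; apply/matrixP => i j; rewrite !mxE.
case: eqP => [_|_]; last by rewrite !mulr0n.
have sq x y : 0 < x -> x * y = c -> Num.sqrt x * y * Num.sqrt x = c.
  by move=> x0 <-; rewrite mulrAC -expr2 sqr_sqrtr ?ltW.
rewrite !mulr1n; move: i; apply: ord3P => /=; apply: sq;
  by [rewrite ?divr_gt0 ?mulr_gt0|field; rewrite !ne].
Qed.

(** U is invertible, so U^T Q U = c can be solved for U U^T = c Q^-1. *)
Lemma cholesky_covmx A D c U : A^T = - A -> 0 < D -> axsq A < D -> c != 0 ->
  U^T *m (D%:M + A *m A) *m U = c%:M -> U *m U^T = c *: covmx A D.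
Proof.
move=> sA D0 lt c0 UQU.
have h : (c^-1 *: (U^T *m (D%:M + A *m A))) *m U = 1%:M.
  by rewrite -scalemxAl UQU scale_scalar_mx mulVf.
have E : U *m U^T *m (D%:M + A *m A) = c%:M.
  have := mulmx1C h; rewrite -scalemxAr mulmxA => /(congr1 ( *:%R c)).
  by rewrite scalerA divff// scale1r scale_scalar_mx mulr1.
by rewrite -[LHS]mulmx1 -(Q_covmx sA D0 lt) mulmxA E mul_scalar_mx.
Qed.

Lemma cholesky_det A D c U : A^T = - A -> axsq A < D -> 0 < c ->
  lower3 U -> 0 < U 0 0 -> 0 < U 1 1 -> 0 < U o2 o2 ->
  U^T *m (D%:M + A *m A) *m U = c%:M ->
  U 0 0 * U 1 1 * U o2 o2 * Num.sqrt (\det (D%:M + A *m A)) = Num.sqrt c ^+ 3.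
Proof.
move=> sA lt c0 [U01 U02 U12] U0 U1 U2 /(congr1 determinant).
rewrite !det_mulmx det_tr det_scalar => E.
have detU : \det U = U 0 0 * U 1 1 * U o2 o2.
  by rewrite det3 U01 U02 U12; ring.
have dU0 : 0 < \det U by rewrite detU !mulr_gt0.
apply/eqP; rewrite -detU -(@eqrXn2 _ 2) ?exprn_ge0 ?sqrtr_ge0//; last first.
  by rewrite mulr_ge0 ?sqrtr_ge0// ltW.
have dQ : 0 <= \det (D%:M + A *m A).
  have : 0 <= \det U ^+ 2 * \det (D%:M + A *m A).
    by rewrite expr2 mulrAC E exprn_ge0 ?ltW.
  by rewrite pmulr_rge0// exprn_gt0.
rewrite exprMn sqr_sqrtr// -exprM mulnC exprM sqr_sqrtr ?ltW//.
by rewrite -E; apply/eqP; ring.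
Qed.

End maxwell0.

(** * Moments of a Maxwell-Boltzmann distribution *)

Section maxwell0.
Context {R : realType}.
Implicit Types (A U : 'M[R]_3) (a b c : R) (x v : 'cV[R]_3).

Definition exponent_form a b c A x v : R :=
  a * sqn x + 2 * b * dot x v + c * sqn v + 2 * dot x (A *m v).

Lemma Xt0 x v : Xt 0 x v = x.
Proof. by rewrite /Xt cos0 sin0 scale1r scale0r subr0. Qed.

Lemma Vt0 x v : Vt 0 x v = v.
Proof. by rewrite /Vt cos0 sin0 scale1r scale0r add0r. Qed.

Lemma maxwellE m y z a b c A t x v : maxwell (m, y, z, a, b, c, A) t x v =
  m * (Num.sqrt (\det ((a * c - b ^+ 2)%:M + A *m A)) / (2 * pi) ^+ 3) *
  expR (- (2^-1 * exponent_form a b c A (Xt t x v - y) (Vt t x v - z))).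
Proof. by []. Qed.

Lemma measurable_maxwell0 (p : septuple R) : measurable_fun setT (on6 (maxwell p 0)).
Proof.
case: p => [[[[[[m y] z] a] b] c] A].
have mx i : measurable_fun setT (fun q : mR3 R * mR3 R =>
  (Xt 0 (vec3 q.1) (vec3 q.2) - y) i 0).
  have -> : (fun q : mR3 R * mR3 R => (Xt 0 (vec3 q.1) (vec3 q.2) - y) i 0) =
            (fun q => vec3 q.1 i 0 - y i 0).
    by apply/funext => q; rewrite Xt0 !mxE.
  by apply: measurable_funB => //; exact: measurable_on6_x.
have mv i : measurable_fun setT (fun q : mR3 R * mR3 R =>
  (Vt 0 (vec3 q.1) (vec3 q.2) - z) i 0).
  have -> : (fun q : mR3 R * mR3 R => (Vt 0 (vec3 q.1) (vec3 q.2) - z) i 0) =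
            (fun q => vec3 q.2 i 0 - z i 0).
    by apply/funext => q; rewrite Vt0 !mxE.
  by apply: measurable_funB => //; exact: measurable_on6_v.
have mdot (f g : mR3 R * mR3 R -> 'cV[R]_3) :
    (forall i, measurable_fun setT (fun q => f q i 0)) ->
    (forall i, measurable_fun setT (fun q => g q i 0)) ->
    measurable_fun setT (fun q => dot (f q) (g q)).
  move=> mf mg; under eq_fun do rewrite /dot sum3.
  by apply: measurable_funD; [apply: measurable_funD|];
    apply: measurable_funM; (exact: mf || exact: mg).
have mA (g : mR3 R * mR3 R -> 'cV[R]_3) :
    (forall i, measurable_fun setT (fun q => g q i 0)) ->
    forall i, measurable_fun setT (fun q => (A *m g q) i 0).
  move=> mg i; under eq_fun do rewrite mxE sum3.
  by apply: measurable_funD; [apply: measurable_funD|];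
    apply: measurable_funM => //; exact: mg.
rewrite /on6; under eq_fun do rewrite maxwellE /exponent_form /sqn.
apply: measurable_funM => //; apply: measurableT_comp => //.
apply: measurableT_comp => //; apply: measurable_funM => //.
apply: measurable_funD; last by apply: measurable_funM => //; apply: mdot => //;
  exact: mA.
apply: measurable_funD; last by apply: measurable_funM => //; exact: mdot.
by apply: measurable_funD; apply: measurable_funM => //; exact: mdot.
Qed.

(** Completing the square in v: for given u the form is minimal at
    c^-1 (A u - b u), where its value is c^-1 times the value of Q at u. *)
Lemma exponent_form_complete a b c A s (u eta : 'cV[R]_3) :
  A^T = - A -> s != 0 -> c = (s ^+ 2)^-1 ->
  exponent_form a b c A u (c^-1 *: (A *m u - b *: u) + s *: eta) =
  sqn eta + c^-1 * dot u (((a * c - b ^+ 2)%:M + A *m A) *m u).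
Proof.
move=> /skewE sA s0 ->.
rewrite /exponent_form /sqn /dot !(mxE, sum3) /= !sA.
by field.
Qed.

(** Diagonalize the exponent by [exponent_form_complete] and [cholesky_Q].  The
    covariance matrix comes out as the inverse of the precision matrix; its
    blocks are c Q^-1, - Q^-1 (b + A) and a Q^-1 because A commutes with Q. *)
Lemma maxwell0_has_moments m (y z : 'cV[R]_3) a b c A : calO a b c A ->
  let G := covmx A (a * c - b ^+ 2) in
  has_moments (maxwell (m, y, z, a, b, c, A) 0) m (m *: y) (m *: z)
    (m *: (y *m y^T + c *: G)) (m *: (y *m z^T - G *m (b%:M + A)))
    (m *: (z *m z^T + a *: G)).
Proof.
move=> /calOE[a0 c0 sA]; set D := a * c - b ^+ 2 => lt G.
have D0 : 0 < D := le_lt_trans (axsq_ge0 A) lt.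
have [U [lU U0 U1 U2 UQU]] := cholesky_Q sA lt c0.
have UU := cholesky_covmx sA D0 lt (lt0r_neq0 c0) UQU.
have dU := cholesky_det sA lt c0 lU U0 U1 U2 UQU.
(* The conditional variance of v given x is 1 / c. *)
pose s := (Num.sqrt c)^-1; have s0 : 0 < s by rewrite invr_gt0 sqrtr_gt0.
have s2 : s ^+ 2 = c^-1 by rewrite exprVn sqr_sqrtr// ltW.
pose K := c^-1 *: ((A - b%:M) *m U).
have KE q : K *m vec3 q = c^-1 *: (A *m (U *m vec3 q) - b *: (U *m vec3 q)).
  by rewrite /K -scalemxAl -mulmxA mulmxBl mul_scalar_mx.
pose N := m * Num.sqrt (\det (D%:M + A *m A)).
have FE (q : mR3 R * mR3 R) : maxwell (m, y, z, a, b, c, A) 0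
    (y + U *m vec3 q.1) (z + K *m vec3 q.1 + s *: vec3 q.2) = N * gauss6 q.
  rewrite maxwellE Xt0 Vt0 (addrC y) addrK -(addrA z) (addrC z) addrK KE.
  rewrite exponent_form_complete ?gt_eqF// ?s2 ?invrK//.
  have -> : dot (U *m vec3 q.1) ((D%:M + A *m A) *m (U *m vec3 q.1)) =
      c * sqn (vec3 q.1).
    rewrite dotE trmx_mul -!mulmxA (mulmxA U^T) (mulmxA (U^T *m _)).
    by rewrite UQU mul_scalar_mx -scalemxAr mxE -dotE.
  rewrite mulKf ?gt_eqF// /gauss6 /gauss3 /phi /N /sqn /dot !sum3 !vec3E.
  set w := (Num.sqrt (2 * pi))^-1.
  have -> : ((2 * pi) ^+ 3)^-1 = w ^+ 6 :> R.
    rewrite /w exprVn (_ : 6%N = (2 * 3)%N)// exprM sqr_sqrtr//.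
    by rewrite mulr_ge0 ?pi_ge0.
  rewrite (_ : - _ = - (2^-1 * q.1.1.1 ^+ 2) + - (2^-1 * q.1.1.2 ^+ 2)
    + - (2^-1 * q.1.2 ^+ 2) + - (2^-1 * q.2.1.1 ^+ 2)
    + - (2^-1 * q.2.1.2 ^+ 2) + - (2^-1 * q.2.2 ^+ 2)); last by ring.
  by rewrite !expRD -/D; ring.
have := gaussian_has_moments (measurable_maxwell0 _) lU U0 U1 U2 s0 FE.
have -> : U 0 0 * U 1 1 * U o2 o2 * s ^+ 3 * N = m.
  rewrite /N (_ : _ * (m * _) = m * s ^+ 3 * (U 0 0 * U 1 1 * U o2 o2 *
    Num.sqrt (\det (D%:M + A *m A)))); last by ring.
  by rewrite dU -mulrA -exprMn mulVf ?expr1n ?mulr1// gt_eqF// sqrtr_gt0.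
have UK : U *m K^T = - (G *m (b%:M + A)).
  rewrite /K linearZ/= trmx_mul -scalemxAr mulmxA UU -scalemxAl scalerA.
  rewrite mulVf ?gt_eqF// scale1r -/G linearB/= tr_scalar_mx sA -opprD mulmxN.
  by rewrite addrC.
have QG : (D%:M + A *m A) *m G = 1%:M by exact: Q_covmx.
have AG : A *m G = G *m A by exact: covmx_comm.
have KK : K *m K^T + (s ^+ 2)%:M = a *: G.
  rewrite {1}/K -scalemxAl -mulmxA UK mulmxN scalerN.
  have -> : (s ^+ 2)%:M = c^-1 *: ((D%:M + A *m A) *m G).
    by rewrite QG scale_scalar_mx mulr1 s2.
  have -> : G *m (b%:M + A) = (b%:M + A) *m G.
    by rewrite mulmxDr mulmxDl AG mul_mx_scalar mul_scalar_mx.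
  have -> : (A - b%:M) *m ((b%:M + A) *m G) = (A *m A - (b ^+ 2)%:M) *m G.
    rewrite mulmxA; congr (_ *m _).
    rewrite mulmxBl !mulmxDr mul_mx_scalar !mul_scalar_mx scale_scalar_mx -expr2.
    by rewrite [X in _ - X]addrC opprD addrA [X in X - _ - _]addrC addrK.
  rewrite -scalerN -scalerDr -mulNmx -mulmxDl.
  have -> : - (A *m A - (b ^+ 2)%:M) + (D%:M + A *m A) = (c * a)%:M.
    by rewrite /D; apply/matrixP => i j; rewrite !mxE; case: eqP => _;
      rewrite ?mulr1n ?mulr0n; ring.
  by rewrite mul_scalar_mx scalerA mulrA mulVf ?mul1r// gt_eqF.
rewrite UU -/G UK -addrA KK.
by [].
Qed.
End maxwell0.

Section Psi.
Context {R : realType}.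
Implicit Types (A U : 'M[R]_3) (a b c t : R) (x v y z : 'cV[R]_3).

(** The moments as a function of the parameters; tau is the trace of the
    inverse of Q. *)
Definition maxwell_moments (p : septuple R) : septuple R :=
  let '(m, y, z, a, b, c, A) := p in
  let D := a * c - b ^+ 2 in let tau := D^-1 + 2 / (D - axsq A) in
  (m, m *: y, m *: z, m * (sqn y + c * tau), m * (dot y z - b * tau),
   m * (sqn z + a * tau), m *: (wedge y z - (2 / (D - axsq A)) *: A)).

Lemma has_int_int6 (f : 'cV[R]_3 -> 'cV[R]_3 -> R) k :
  has_int (@leb6 R) (on6 f) k -> int6 f = k.
Proof. by case. Qed.

Lemma trE (M : 'M[R]_3) : \tr M = \sum_i M i i. Proof. by []. Qed.

(** (X(t), V(t)) is a rotation of (x, v), so the conserved quantities are linear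
    combinations of those at time zero; X /\ V is unchanged because the
    rotation has determinant one. *)
Lemma has_moments_rot F m y z Mxx Mxv Mvv t :
  has_moments F m y z Mxx Mxv Mvv ->
  moments (Xt t) (Vt t) F =
  (m, cos t *: y - sin t *: z, sin t *: y + cos t *: z,
   cos t ^+ 2 * \tr Mxx - 2 * (cos t * sin t) * \tr Mxv + sin t ^+ 2 * \tr Mvv,
   cos t * sin t * \tr Mxx + (cos t ^+ 2 - sin t ^+ 2) * \tr Mxv
     - cos t * sin t * \tr Mvv,
   sin t ^+ 2 * \tr Mxx + 2 * (cos t * sin t) * \tr Mxv + cos t ^+ 2 * \tr Mvv,
   Mxv - Mxv^T).
Proof.
move=> [h0 [hx hv] hxx hxv hvv]; have CS := cos2Dsin2 t.
set C := cos t in CS *; set S := sin t in CS *.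
have htr (M : 'M[R]_3) (g : 'I_3 -> 'cV[R]_3 -> 'cV[R]_3 -> R) :
    (forall i, has_int (@leb6 R) (on6 (fun x v => F x v * g i x v)) (M i i)) ->
    has_int (@leb6 R) (on6 (fun x v => F x v * \sum_i g i x v)) (\tr M).
  move=> h; apply: (has_int_eq (has_int_sum (index_enum _) predT h)) => // q.
  by rewrite /on6 mulr_sumr.
have txx := htr _ (fun i x v => x i 0 * x i 0) (fun i => hxx i i).
have txv := htr _ (fun i x v => x i 0 * v i 0) (fun i => hxv i i).
have tvv := htr _ (fun i x v => v i 0 * v i 0) (fun i => hvv i i).
have comb k1 k2 k3 (g : 'cV[R]_3 -> 'cV[R]_3 -> R) :
    (forall x v, g x v = k1 * sqn x + k2 * dot x v + k3 * sqn v) ->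
    int6 (fun x v => F x v * g x v) = k1 * \tr Mxx + k2 * \tr Mxv + k3 * \tr Mvv.
  move=> gE; apply: has_int_int6; apply: (has_int_eq
    (has_intD (has_intD (has_intZ k1 txx) (has_intZ k2 txv)) (has_intZ k3 tvv))) =>
      // q.
  by rewrite /on6 gE /sqn /dot; ring.
rewrite /moments; congr (_, _, _, _, _, _, _).
- exact: has_int_int6.
- apply/matrixP => i j; rewrite (ord1 j) !mxE; apply: has_int_int6.
  apply: (has_int_eq (has_intD (has_intZ C (hx i)) (has_intZ (- S) (hv i)))) => [q|].
    by rewrite /on6 /Xt !mxE -/C -/S; ring.
  by ring.
- apply/matrixP => i j; rewrite (ord1 j) !mxE; apply: has_int_int6.
  apply: (has_int_eq (has_intD (has_intZ S (hx i)) (has_intZ C (hv i)))) => // q.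
  by rewrite /on6 /Vt !mxE -/C -/S; ring.
- rewrite (@comb (C ^+ 2) (- (2 * (C * S))) (S ^+ 2)) ?mulNr// => x v.
  by rewrite /sqn /dot /Xt !sum3 !mxE -/C -/S; ring.
- rewrite (@comb (C * S) (C ^+ 2 - S ^+ 2) (- (C * S))) ?mulNr// => x v.
  by rewrite /sqn /dot /Xt /Vt !sum3 !mxE -/C -/S; ring.
- rewrite (@comb (S ^+ 2) (2 * (C * S)) (C ^+ 2))// => x v.
  by rewrite /sqn /dot /Vt !sum3 !mxE -/C -/S; ring.
- apply/matrixP => i j; rewrite !mxE; apply: has_int_int6.
  apply: (has_int_eq (has_intD (hxv i j) (has_intZ (-1) (hxv j i)))) => [q|].
    rewrite /on6; move: (vec3 q.1) (vec3 q.2) => X V.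
    rewrite /wedge /Xt /Vt !mxE !big_ord1 !mxE -/C -/S.
    transitivity (F X V * ((C ^+ 2 + S ^+ 2) * (X i 0 * V j 0 - X j 0 * V i 0))).
      by rewrite CS; ring.
    by ring.
  by ring.
Qed.

(** The parameters at time zero of the distribution seen at time t. *)
Definition rotate_params t (p : septuple R) : septuple R :=
  let '(m, y, z, a, b, c, A) := p in
  (m, cos t *: y + sin t *: z, cos t *: z - sin t *: y,
   a * cos t ^+ 2 + 2 * b * (cos t * sin t) + c * sin t ^+ 2,
   (c - a) * (cos t * sin t) + b * (cos t ^+ 2 - sin t ^+ 2),
   a * sin t ^+ 2 - 2 * b * (cos t * sin t) + c * cos t ^+ 2, A).

Lemma rotate_disc a b c t :
  (a * cos t ^+ 2 + 2 * b * (cos t * sin t) + c * sin t ^+ 2) *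
  (a * sin t ^+ 2 - 2 * b * (cos t * sin t) + c * cos t ^+ 2) -
  ((c - a) * (cos t * sin t) + b * (cos t ^+ 2 - sin t ^+ 2)) ^+ 2 =
  a * c - b ^+ 2.
Proof.
transitivity ((a * c - b ^+ 2) * (cos t ^+ 2 + sin t ^+ 2) ^+ 2); first by ring.
by rewrite cos2Dsin2 expr1n mulr1.
Qed.

Lemma rotate_calO m y z a b c A t : calO a b c A ->
  let '(_, _, _, a', b', c', A') := rotate_params t (m, y, z, a, b, c, A) in
  calO a' b' c' A'.
Proof.
move=> /calOE[a0 c0 sA lt]; rewrite /rotate_params; apply/calOE.
rewrite rotate_disc; split => //.
  have := cos2Dsin2 t; set C := cos t; set S := sin t => CS.
  have D0 : 0 < a * c - b ^+ 2 by exact: le_lt_trans (axsq_ge0 A) lt.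
  rewrite -(pmulr_rgt0 _ a0).
  have -> : a * (a * C ^+ 2 + 2 * b * (C * S) + c * S ^+ 2) =
     (a * C + b * S) ^+ 2 + (a * c - b ^+ 2) * S ^+ 2 by ring.
  have [S0|Sn0] := eqVneq S 0.
    have C1 : C ^+ 2 = 1 by rewrite -CS S0 expr0n addr0.
    rewrite S0 mulr0 addr0 expr0n mulr0 addr0 exprMn C1 mulr1 exprn_gt0//.
  by rewrite ltr_wpDl ?sqr_ge0// mulr_gt0// lt_def sqr_ge0 expf_neq0.
  have := cos2Dsin2 t; set C := cos t; set S := sin t => CS.
  have D0 : 0 < a * c - b ^+ 2 by exact: le_lt_trans (axsq_ge0 A) lt.
  rewrite -(pmulr_rgt0 _ a0).
  have -> : a * (a * S ^+ 2 - 2 * b * (C * S) + c * C ^+ 2) =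
     (a * S - b * C) ^+ 2 + (a * c - b ^+ 2) * C ^+ 2 by ring.
  have [C0|Cn0] := eqVneq C 0.
    have S1 : S ^+ 2 = 1 by rewrite -CS C0 expr0n add0r.
    rewrite C0 mulr0 subr0 expr0n mulr0 addr0 exprMn S1 mulr1 exprn_gt0//.
  by rewrite ltr_wpDl ?sqr_ge0// mulr_gt0// lt_def sqr_ge0 expf_neq0.
Qed.

(** A rotation in phase space maps the family of quadratic forms into itself:
    it keeps the skew part and the discriminant, so no change of variables is
    needed to integrate at time t. *)
Lemma maxwell_rotate (p : septuple R) t : maxwell_params p ->
  maxwell p t = maxwell (rotate_params t p) 0.
Proof.
case: p => [[[[[[m y] z] a] b] c] A] [m0 /calOE[a0 c0 sA lt]].
apply/funext => x; apply/funext => v; rewrite /rotate_params !maxwellE.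
rewrite rotate_disc Xt0 Vt0; congr (_ * expR (- (_ * _))).
have CS := cos2Dsin2 t.
have -> : Xt t x v - y =
    cos t *: (x - (cos t *: y + sin t *: z)) - sin t *: (v - (cos t *: z - sin t *: y)).
  rewrite -{1}[y]scale1r -CS /Xt; apply/matrixP => i j; rewrite !mxE; ring.
have -> : Vt t x v - z =
    sin t *: (x - (cos t *: y + sin t *: z)) + cos t *: (v - (cos t *: z - sin t *: y)).
  rewrite -{1}[z]scale1r -CS /Vt; apply/matrixP => i j; rewrite !mxE; ring.
move: (x - _) (v - _) => xi eta; have sE := skewE sA.
set C := cos t in CS *; set S := sin t in CS *.
have E : dot (C *: xi - S *: eta) (A *m (S *: xi + C *: eta)) =
   (C ^+ 2 + S ^+ 2) * dot xi (A *m eta).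
  by rewrite /dot !(mxE, sum3) /= !sE; ring.
by rewrite /exponent_form E CS mul1r /sqn /dot !(mxE, sum3) /=; ring.
Qed.

Lemma Psi_maxwell (p : septuple R) t : maxwell_params p ->
  Psi (maxwell p) t = maxwell_moments p.
Proof.
move=> pp; rewrite /Psi (maxwell_rotate t pp).
case: p pp => [[[[[[m y] z] a] b] c] A] [m0 O].
have := rotate_calO m y z t O; rewrite /rotate_params => O'.
rewrite (has_moments_rot t (maxwell0_has_moments _ _ _ O')) rotate_disc.
case/calOE: O => a0 c0 sA; rewrite /maxwell_moments.
set D := a * c - b ^+ 2 => lt; have D0 : 0 < D := le_lt_trans (axsq_ge0 A) lt.
set G := covmx A D; have trG : \tr G = _ := tr_covmx sA D0 lt.
have trA : \tr A = 0 by rewrite trE sum3 !(skewE sA); ring.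
have trAG : \tr (G *m A) = 0.
  by rewrite -covmx_comm skew_covmx// mxtraceZ trA mulr0.
have CS := cos2Dsin2 t; set C := cos t in CS *; set S := sin t in CS *.
have trd u w : \tr (u *m w^T) = dot u w :> R.
  by rewrite trE /dot; apply: eq_bigr => i _; rewrite mxE big_ord1 mxE.
have T1 k u : \tr (m *: (u *m u^T + k *: G)) = m * (sqn u + k * (D^-1 + 2 / (D -
  axsq A))).
  by rewrite mxtraceZ mxtraceD trd mxtraceZ trG.
have T2 k u w : \tr (m *: (u *m w^T - G *m (k%:M + A))) =
    m * (dot u w - k * (D^-1 + 2 / (D - axsq A))).
  by rewrite mxtraceZ raddfB/= trd mulmxDr mxtraceD trAG mul_mx_scalar mxtraceZ trG
    addr0.
rewrite !T1 !T2; congr (_, _, _, _, _, _, _).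
- transitivity (m *: ((C ^+ 2 + S ^+ 2) *: y)); last by rewrite CS scale1r.
  by apply/matrixP => i j; rewrite !mxE; ring.
- transitivity (m *: ((C ^+ 2 + S ^+ 2) *: z)); last by rewrite CS scale1r.
  by apply/matrixP => i j; rewrite !mxE; ring.
- transitivity (m * ((C ^+ 2 + S ^+ 2) ^+ 2 * (sqn y + c * (D^-1 + 2 / (D - axsq A))))).
    by rewrite /sqn /dot !sum3 !mxE; ring.
  by rewrite CS expr1n mul1r.
- transitivity (m * ((C ^+ 2 + S ^+ 2) ^+ 2 * (dot y z - b * (D^-1 + 2 / (D - axsq
  A))))).
    by rewrite /sqn /dot !sum3 !mxE; ring.
  by rewrite CS expr1n mul1r.
- transitivity (m * ((C ^+ 2 + S ^+ 2) ^+ 2 * (sqn z + a * (D^-1 + 2 / (D - axsq A))))).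
    by rewrite /sqn /dot !sum3 !mxE; ring.
  by rewrite CS expr1n mul1r.
- set y' := C *: y + S *: z; set z' := C *: z - S *: y.
  set b' := (c - a) * (C * S) + b * (C ^+ 2 - S ^+ 2).
  have GT : G^T = G.
    rewrite /G /covmx linearZ/= linearB/= linearZ/= trmx1 trmx_mul sA.
    by rewrite mulNmx mulmxN opprK.
  have E : G *m (b'%:M + A) - (G *m (b'%:M + A))^T = (2 / (D - axsq A)) *: A.
    have -> : (G *m (b'%:M + A))^T = (b'%:M - A) *m G.
      rewrite trmx_mul GT; congr (_ *m _).
      by apply/matrixP => i j; rewrite -[A in RHS]opprK -sA !mxE eq_sym opprK.
    rewrite mulmxDr mulmxBl mul_mx_scalar mul_scalar_mx opprB.
    rewrite addrC addrA subrK -[X in _ + X](covmx_comm A D) -/G.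
    by rewrite skew_covmx// -scalerDl; congr (_ *: _); ring.
  (* Only the antisymmetric part of the mixed moments is conserved. *)
  have alg (P H W : 'M[R]_3) : W = P - P^T -> P - H - (P - H)^T = W - (H - H^T).
    by move=> ->; apply/matrixP => i j; rewrite !mxE; ring.
  rewrite linearZ/= -scalerBr -E; congr (_ *: _); apply: alg.
  transitivity ((C ^+ 2 + S ^+ 2) *: wedge y z); first by rewrite CS scale1r.
  by rewrite /y' /z' /wedge; apply/matrixP => i j; rewrite !(mxE, big_ord1); ring.
Qed.

End Psi.

(** * Inverting the map from parameters to moments *)

Section inverse.
Context {R : realType}.
Implicit Types (A W : 'M[R]_3) (V p : septuple R).

(** Mass, mean, and second moments about the mean per unit of mass.  In these
    coordinates the mean decouples from the remaining parameters. *)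
Definition central V : septuple R :=
  let '(m, y, z, s, r, u, W) := V in
  let y' := m^-1 *: y in let z' := m^-1 *: z in
  (m, y', z', s / m - sqn y', r / m - dot y' z', u / m - sqn z',
   m^-1 *: W - wedge y' z').

Definition uncentral V : septuple R :=
  let '(m, y, z, s, r, u, W) := V in
  (m, m *: y, m *: z, m * (sqn y + s), m * (dot y z + r), m * (sqn z + u),
   m *: (wedge y z + W)).

(** Let Delta = s u - r ^ 2.  The axial length q of W in units of sqrt Delta
    and the axial length sigma of A in units of sqrt D are related by
    q = 2 sigma / (3 - sigma ^ 2), an increasing bijection of [0, 1[ whose inverse
    is 3 q / (1 + k) with k = sqrt (1 + 3 q ^ 2); the remaining entries follow. *)
Definition central_params V : septuple R :=
  let '(m, y, z, s, r, u, W) := V in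
  let k := Num.sqrt (1 + 3 * axsq W / (s * u - r ^+ 2)) in
  let h := (s * u - r ^+ 2) * (2 - k) in
  (m, y, z, 3 * u / h, - (3 * r / h), 3 * s / h, (- (9 / (h * (k + 1)))) *: W).

(** The counterpart of [maxwell_moments] in the coordinates of [central]. *)
Definition central_moments p : septuple R :=
  let '(m, y, z, a, b, c, A) := p in
  let D := a * c - b ^+ 2 in let tau := D^-1 + 2 / (D - axsq A) in
  (m, y, z, c * tau, - (b * tau), a * tau, (- (2 / (D - axsq A))) *: A).

(** The range of [central_moments]; k < 2 in [central_params] is the last
    condition. *)
Definition admissible V : Prop :=
  let '(m, y, z, s, r, u, W) := V in
  [/\ 0 < m, 0 < s, 0 < u, W^T = - W & axsq W < s * u - r ^+ 2].

Lemma centralK V : V.1.1.1.1.1.1 != 0 -> uncentral (central V) = V.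
Proof.
case: V => [[[[[[m y] z] s] r] u] W] /= m0.
rewrite !scalerA divff// !scale1r; congr (_, _, _, _, _, _, _); try by field.
by rewrite addrC subrK scalerA divff// scale1r.
Qed.

Lemma uncentralK V : V.1.1.1.1.1.1 != 0 -> central (uncentral V) = V.
Proof.
case: V => [[[[[[m y] z] s] r] u] W] /= m0.
rewrite !scalerA mulVf// !scale1r; congr (_, _, _, _, _, _, _); try by field.
by rewrite addrC addrA addNr add0r.
Qed.

Lemma axsqZ k A : axsq (k *: A) = k ^+ 2 * axsq A.
Proof. by rewrite /axsq !mxE; ring. Qed.

Lemma maxwell_momentsE p : maxwell_moments p = uncentral (central_moments p).
Proof.
case: p => [[[[[[m y] z] a] b] c] A] /=; congr (_, _, _, _, _, _, _).
by rewrite scaleNr.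
Qed.

(** On the image of a parameter, k is the rational expression
    (3 D + rho) / (3 D - rho) with rho = axsq A, because the radicand is its
    square; everything else is then rational. *)
Lemma central_momentsK p : maxwell_params p ->
  admissible (central_moments p) /\ central_params (central_moments p) = p.
Proof.
case: p => [[[[[[m y] z] a] b] c] A] [m0 /calOE[a0 c0 sA lt]] /=.
have D0 := le_lt_trans (axsq_ge0 A) lt.
rewrite !axsqZ.
have Nz : (- (2 / (a * c - b ^+ 2 - axsq A))) ^+ 2 = 4 / (a * c - b ^+ 2 - axsq A) ^+ 2.
  by field; rewrite gt_eqF// subr_gt0.
rewrite Nz; have rho0 := axsq_ge0 A.
have disc tau : c * tau * (a * tau) - (- (b * tau)) ^+ 2 = (a * c - b ^+ 2) * tau ^+ 2.
  by ring.
rewrite disc; move: D0 lt rho0; set D := a * c - b ^+ 2;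
  set rho := axsq A => D0 lt rho0.
set e := D - rho; have e0 : 0 < e by rewrite subr_gt0.
have g0 : 0 < 3 * D - rho by rewrite /D /rho in lt rho0 D0 *; lra.
have e0' : 0 < D - rho by [].
have k1 : 0 < 3 * D + rho + (3 * D - rho) by rewrite /D /rho in lt rho0 D0 *; lra.
have f0 : 0 < 2 * (3 * D - rho) - (3 * D + rho) by rewrite /D /rho in lt rho0 D0 *; lra.
set tau := D^-1 + 2 / e.
have tauE : tau = (3 * D - rho) / (D * e).
  by rewrite /tau /e; field; rewrite !gt_eqF.
have tau0 : 0 < tau by rewrite tauE divr_gt0// mulr_gt0.
(* tau ^ 2 D is the discriminant of the central moments. *)
have kE : Num.sqrt (1 + 3 * (4 / e ^+ 2 * rho) / (D * tau ^+ 2)) = (3 * D + rho) /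
  (3 * D - rho).
  have -> : 1 + 3 * (4 / e ^+ 2 * rho) / (D * tau ^+ 2) = ((3 * D + rho) / (3 * D -
    rho)) ^+ 2.
    by rewrite tauE /e; field; rewrite !gt_eqF.
  by rewrite sqrtr_sqr ger0_norm// divr_ge0; lra.
rewrite kE; split.
  split => //; try exact: mulr_gt0.
    by rewrite linearZ/= sA scalerN.
  rewrite tauE -subr_gt0.
  have -> : D * ((3 * D - rho) / (D * e)) ^+ 2 - 4 / e ^+ 2 * rho =
     (9 * D - rho) / (D * e).
    by rewrite /e; field; rewrite !gt_eqF.
  by rewrite divr_gt0 ?mulr_gt0//; lra.
congr (_, _, _, _, _, _, _).
- by rewrite tauE /e; field; rewrite !gt_eqF.
- by rewrite tauE /e; field; rewrite !gt_eqF.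
- by rewrite tauE /e; field; rewrite !gt_eqF.
- rewrite scalerA (_ : _ * _ = 1) ?scale1r// tauE /e; field.
  by rewrite !gt_eqF.
Qed.

(** With w = Delta (k ^ 2 - 1) / 3 every quantity becomes rational in Delta and
    k; in particular D = 9 / (h (2 - k)), D - rho = 18 / (h (k + 1)) and
    tau = h / 3. *)
Lemma central_paramsK V : admissible V ->
  maxwell_params (central_params V) /\ central_moments (central_params V) = V.
Proof.
case: V => [[[[[[m y] z] s] r] u] W] [m0 s0 u0 sW lt] /=.
have w0 := axsq_ge0 W.
move: w0 lt; set D := s * u - r ^+ 2; set w := axsq W => w0 lt.
have D0 : 0 < D := le_lt_trans w0 lt.
set k := Num.sqrt _.
have k2 : k ^+ 2 = 1 + 3 * w / D.
  by rewrite sqr_sqrtr// addr_ge0// divr_ge0 //; [exact: mulr_ge0|exact: ltW].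
have k_ge0 : 0 <= k by exact: sqrtr_ge0.
have q1 : w / D < 1 by rewrite ltr_pdivrMr// mul1r.
have q0 : 0 <= w / D by rewrite divr_ge0// ltW.
have k_lt2 : k < 2 by rewrite -mulrA in k2; nra.
have k_ge1 : 1 <= k by rewrite -mulrA in k2; nra.
have wE : w = D * (k ^+ 2 - 1) / 3 by rewrite k2; field; rewrite gt_eqF.
set h := D * (2 - k); have h0 : 0 < h by rewrite mulr_gt0// subr_gt0.
have disc : 3 * u / h * (3 * s / h) - (- (3 * r / h)) ^+ 2 = 9 / (h * (2 - k)).
  transitivity (9 * D / h ^+ 2); first by rewrite /D; field; rewrite gt_eqF.
  by rewrite /h; field; rewrite !gt_eqF// subr_gt0.
have axR : axsq (- (9 / (h * (k + 1))) *: W) = 9 / (h * (2 - k)) - 18 / (h * (k + 1)).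
  by rewrite axsqZ -/w wE /h; field; rewrite !gt_eqF//; lra.
have e0 : 0 < 18 / (h * (k + 1)) by rewrite divr_gt0// mulr_gt0//; lra.
rewrite disc axR; split.
  split => //; apply/calOE; rewrite disc axR; split.
  - by rewrite divr_gt0// mulr_gt0.
  - by rewrite divr_gt0// mulr_gt0.
  - by rewrite linearZ/= sW scalerN.
  - lra.
rewrite subKr.
have -> : (9 / (h * (2 - k)))^-1 + 2 / (18 / (h * (k + 1))) = h / 3.
  by field; rewrite !gt_eqF//; lra.
congr (_, _, _, _, _, _, _).
- by field; rewrite !gt_eqF.
- by field; rewrite !gt_eqF.
- by field; rewrite !gt_eqF.
- rewrite scalerA (_ : _ * _ = 1) ?scale1r//; field; rewrite !gt_eqF//; lra.
Qed.

Definition moments_params V : septuple R := central_params (central V).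

Lemma maxwell_momentsK p : maxwell_params p ->
  moments_params (maxwell_moments p) = p.
Proof.
move=> pp; have [adm E] := central_momentsK pp.
rewrite /moments_params maxwell_momentsE uncentralK ?E//.
by case: p pp {adm E} => [[[[[[m y] z] a] b] c] A] [m0 _] /=; rewrite gt_eqF.
Qed.

Lemma moments_paramsK V : admissible (central V) ->
  maxwell_params (moments_params V) /\ maxwell_moments (moments_params V) = V.
Proof.
move=> adm; have [pp E] := central_paramsK adm; split=> //.
rewrite maxwell_momentsE /moments_params E centralK//.
by case: V adm {pp E} => [[[[[[m y] z] s] r] u] W] [m0 *] /=; rewrite gt_eqF.
Qed.

End inverse.

(** * Moments of an arbitrary density *)

(** If the integral of f g vanished, f would vanish almost everywhere where g is
    positive, hence almost everywhere, and so would the integral of f w. *)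
Lemma has_int_weight_gt0 d (T : measurableType d) (R : realType)
    (mu : {measure set T -> \bar R}) (f g w : T -> R) (c : R) (N : set T) :
  measurable_fun setT f -> measurable_fun setT w ->
  (forall x, 0 <= f x) -> (forall x, 0 <= g x) -> (forall x, 0 <= w x) ->
  has_int mu (fun x => f x * g x) c -> (0 < \int[mu]_x (f x * w x)%:E)%E ->
  measurable N -> mu N = 0%E -> (forall x, ~ N x -> 0 < g x) -> 0 < c.
Proof.
move=> mf mw f0 g0 w0 [ifg fgc] fw_gt0 mN N0 gN.
have c0 : 0 <= c by rewrite -fgc; apply: Rintegral_ge0 => x _; rewrite mulr_ge0.
rewrite lt_def c0 andbT; apply/eqP => cE; move: fw_gt0.
suff -> : (\int[mu]_x (f x * w x)%:E)%E = 0%E by rewrite ltxx.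
have mfg := measurable_int _ ifg.
have fg0 : (\int[mu]_x `|(f x * g x)%:E|)%E = 0%E.
  transitivity (\int[mu]_x (f x * g x)%:E)%E.
    by apply: eq_integral => x _; rewrite gee0_abs// lee_fin mulr_ge0.
  have := integrable_fin_num measurableT ifg => /= /fineK <-.
  by congr EFin; rewrite -cE -fgc.
have aefg := (ae_eq_integral_abs mu measurableT mfg).1 fg0.
rewrite (@ge0_ae_eq_integral _ _ _ mu setT _ (cst 0%E)) ?integral0//.
- by apply/measurable_EFinP; exact: measurable_funM.
- by move=> x _; rewrite lee_fin mulr_ge0.
- have aeN : {ae mu, forall x, ~ N x}.
    by exists N; split => // x /= /contrapT.
  move: aefg aeN; apply: filterS2 => x /= fgx /gN gx _.
  have /eqP := fgx I; rewrite eqe mulf_eq0 (gt_eqF gx) orbF => /eqP ->.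
  by rewrite mul0r.
Qed.

Section null_sets.
Context {R : realType}.

Lemma leb3_plane (k : R) : @leb3 R [set p | p.1.1 = k] = 0%E.
Proof.
have -> : [set p : mR3 R | p.1.1 = k] = ([set k] `*` setT) `*` setT.
  by apply/seteqP; split => p /=; [|case=> -[]].
have m1 : measurable ([set k] : set (measurableTypeR R)) by exact: measurable_set1.
rewrite [LHS](@product_measure1E _ _ _ _ _ (@leb2 R) (@lebesgue_measure R))//;
  last exact: measurableX.
rewrite [X in (X * _)%E](@product_measure1E _ _ _ _ _ (@lebesgue_measure R)
  (@lebesgue_measure R))//.
by rewrite [X in (X * _ * _)%E]lebesgue_measure_set1 !mul0e.
Qed.

Lemma measurable_plane (k : R) : measurable [set p : mR3 R | p.1.1 = k].
Proof.
have m1 : measurable_fun [set: mR3 R] (fun p => p.1.1).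
  exact: (measurableT_comp measurable_fst measurable_fst).
by rewrite -[X in measurable X]setTI; exact: (m1 measurableT [set k]
  (measurable_set1 k)).
Qed.

Lemma leb6_vertical (k : R) :
  measurable [set q : mR3 R * mR3 R | q.1.1.1 = k] /\
  @leb6 R [set q | q.1.1.1 = k] = 0%E.
Proof.
have -> : [set q : mR3 R * mR3 R | q.1.1.1 = k] = [set p : mR3 R | p.1.1 = k] `*` setT.
  by apply/seteqP; split => p /=; [|case].
have mp := measurable_plane k.
split; first exact: measurableX.
rewrite [LHS](@product_measure1E _ _ _ _ _ (@leb3 R) (@leb3 R))//.
by rewrite [X in (X * _)%E]leb3_plane mul0e.
Qed.

(** By Tonelli, because the section over each position is a plane. *)
Lemma leb6_graph (h : mR3 R -> R) : measurable_fun setT h ->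
  measurable [set q : mR3 R * mR3 R | q.2.1.1 = h q.1] /\
  @leb6 R [set q | q.2.1.1 = h q.1] = 0%E.
Proof.
move=> mh; split.
  have m1 : measurable_fun [set: mR3 R * mR3 R] (fun q => q.2.1.1).
    exact: (measurableT_comp measurable_fst
              (measurableT_comp measurable_fst measurable_snd)).
  have m2 : measurable_fun [set: mR3 R * mR3 R] (fun q => (q.2.1.1 : R) - h q.1).
    apply: measurable_funB => //; exact: (measurableT_comp mh measurable_fst).
  have -> : [set q : mR3 R * mR3 R | q.2.1.1 = h q.1] =
     setT `&` (fun q : mR3 R * mR3 R => (q.2.1.1 : R) - h q.1) @^-1` [set 0].
    rewrite setTI; apply/seteqP; split => q /= /eqP; rewrite ?subr_eq0.
      by rewrite -subr_eq0 => /eqP.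
    by move=> /eqP.
  exact: (m2 measurableT [set 0] (measurable_set1 0)).
rewrite [LHS]integral0_eq// => x _ /=.
rewrite (_ : xsection _ x = [set p | p.1.1 = h x]); first exact: leb3_plane.
by apply/seteqP; split => p /=; rewrite /xsection /= inE.
Qed.

End null_sets.

Section calI.
Context {R : realType}.
Implicit Types (F : 'cV[R]_3 -> 'cV[R]_3 -> R) (x v : 'cV[R]_3).

Lemma sqr_le_sqn x i : x i 0 ^+ 2 <= sqn x.
Proof.
rewrite /sqn /dot (bigD1 i)//= expr2 lerDl sumr_ge0// => j _.
by rewrite -expr2 sqr_ge0.
Qed.

Lemma measurable_weight :
  measurable_fun setT (on6 (fun x v : 'cV[R]_3 => 1 + sqn x + sqn v)).
Proof.
apply: measurable_funD; [apply: measurable_funD => //|];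
  rewrite /sqn; under eq_fun do rewrite /dot sum3.
- by apply: measurable_funD; [apply: measurable_funD|];
    apply: measurable_funM; exact: measurable_on6_x.
- by apply: measurable_funD; [apply: measurable_funD|];
    apply: measurable_funM; exact: measurable_on6_v.
Qed.

Lemma weighted_has_moments F : measurable_fun setT (on6 F) ->
  (forall x v, 0 <= F x v) ->
  (\int[@leb6 R]_q (on6 (fun x v => F x v * (1 + sqn x + sqn v)) q)%:E < +oo)%E ->
  exists m y z Mxx Mxv Mvv, has_moments F m y z Mxx Mxv Mvv.
Proof.
move=> mF F0 Foo.
have w0 x v : 0 <= 1 + sqn x + sqn v :> R by rewrite !addr_ge0 ?sqn_ge0.
have iFw : (@leb6 R).-integrable setT
    (EFin \o on6 (fun x v => F x v * (1 + sqn x + sqn v))).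
  apply/integrableP; split.
    by apply/measurable_EFinP; exact: (measurable_funM mF measurable_weight).
  by under eq_integral => q _ do rewrite /= ger0_norm ?mulr_ge0//.
have dom (g : 'cV[R]_3 -> 'cV[R]_3 -> R) : measurable_fun setT (on6 g) ->
    (forall x v, `|g x v| <= 1 + sqn x + sqn v) ->
    has_int (@leb6 R) (on6 (fun x v => F x v * g x v)) (int6 (fun x v =>
      F x v * g x v)).
  move=> mg gw; split => //; apply: le_integrable iFw => //.
    by apply/measurable_EFinP; exact: (measurable_funM mF mg).
  move=> q _; rewrite /= lee_fin /on6 !normrM ler_wpM2l//.
  by rewrite (le_trans (gw _ _))// ler_norm.
have sx := sqn_ge0; have sc := sqr_le_sqn.
have ab (r s : R) : `|r * s| <= (r ^+ 2 + s ^+ 2) / 2.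
  rewrite normrM -(real_normK (num_real r)) -(real_normK (num_real s)).
  by have := sqr_ge0 (`|r| - `|s|); nra.
have a1 (r : R) : `|r| <= (1 + r ^+ 2) / 2 by have := ab 1 r; rewrite mul1r expr1n.
have mx := @measurable_on6_x R; have mv := @measurable_on6_v R.
exists (int6 F), (\col_i int6 (fun x v => F x v * x i 0)),
  (\col_i int6 (fun x v => F x v * v i 0)),
  (\matrix_(i, j) int6 (fun x v => F x v * (x i 0 * x j 0))),
  (\matrix_(i, j) int6 (fun x v => F x v * (x i 0 * v j 0))),
  (\matrix_(i, j) int6 (fun x v => F x v * (v i 0 * v j 0))).
split.
- have F1 : F = (fun x v => F x v * 1).
    by apply/funext => x; apply/funext => v; rewrite mulr1.
  rewrite {1 2}F1; apply: dom => [|x v]; first exact: measurable_cst.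
  by rewrite normr1 -addrA lerDl addr_ge0 ?sqn_ge0.
- split=> i; rewrite mxE; apply: dom => // x v.
  + by have := sc x i; have := sx _ v; have := sx _ x; have := a1 (x i 0); lra.
  + by have := sc v i; have := sx _ x; have := sx _ v; have := a1 (v i 0); lra.
- move=> i j; rewrite mxE; apply: dom => [|x v];
  first exact: (measurable_funM (mx i) (mx j)).
  by have := sc x i; have := sc x j; have := sx _ v; have := ab (x i 0) (x j 0); lra.
- move=> i j; rewrite mxE; apply: dom => [|x v];
  first exact: (measurable_funM (mx i) (mv j)).
  have := sx _ v; have := sx _ x.
  by have := sc x i; have := sc v j; have := ab (x i 0) (v j 0); lra.
- move=> i j; rewrite mxE; apply: dom => [|x v];
  first exact: (measurable_funM (mv i) (mv j)).
  by have := sc v i; have := sc v j; have := sx _ x; have := ab (v i 0) (v j 0); lra.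
Qed.

Lemma has_moments_Psi0 F m y z Mxx Mxv Mvv : has_moments F m y z Mxx Mxv Mvv ->
  Psi0 F = (m, y, z, \tr Mxx, \tr Mxv, \tr Mvv, Mxv - Mxv^T).
Proof.
move=> h; have := has_moments_rot 0 h.
have -> : @Xt R 0 = (fun x _ => x).
  by apply/funext => x; apply/funext => v; rewrite Xt0.
have -> : @Vt R 0 = (fun _ v => v).
  by apply/funext => x; apply/funext => v; rewrite Vt0.
rewrite cos0 sin0 /Psi0 => ->.
by rewrite !scale1r !scale0r subr0 add0r; congr (_, _, _, _, _, _, _); ring.
Qed.

Lemma has_moments_weight F m y z Mxx Mxv Mvv : has_moments F m y z Mxx Mxv Mvv ->
  has_int (@leb6 R) (on6 (fun x v => F x v * (1 + sqn x + sqn v)))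
    (m + \tr Mxx + \tr Mvv).
Proof.
move=> [h0 _ hxx _ hvv].
have txx := has_int_sum (index_enum _) predT (fun i => hxx i i).
have tvv := has_int_sum (index_enum _) predT (fun i => hvv i i).
apply: (has_int_eq (has_intD (has_intD h0 txx) tvv)) => // q.
by rewrite /on6 !mulrDr mulr1 -!mulr_sumr.
Qed.

(** The integral of F against a quadratic polynomial about the mean depends only
    on the central moments.  The skew matrix K selects the antisymmetric part of
    the mixed moments. *)
Lemma has_moments_central F m y z Mxx Mxv Mvv (k1 k2 k3 : R) (K : 'M[R]_3) :
  m != 0 -> has_moments F m y z Mxx Mxv Mvv -> K^T = - K ->
  let '(_, y', z', s, r, u, W) := central (Psi0 F) in
  has_int (@leb6 R) (on6 (fun x v => F x v *
    (k1 * sqn (x - y') + k2 * dot (x - y') (v - z') + k3 * sqn (v - z')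
     + dot (x - y') (K *m (v - z')))))
   (m * (k1 * s + k2 * r + k3 * u
         + (K 1 0 * W 1 0 + K o2 0 * W o2 0 + K o2 1 * W o2 1))).
Proof.
move=> m0 h /skewE sK; rewrite (has_moments_Psi0 h) /central.
set y' := m^-1 *: y; set z' := m^-1 *: z.
have yE i : y i 0 = m * y' i 0 by rewrite mxE mulVKf.
have zE i : z i 0 = m * z' i 0 by rewrite mxE mulVKf.
case: h => h0 [hx hv] hxx hxv hvv.
have cxx i j : has_int (@leb6 R)
    (on6 (fun x v => F x v * ((x - y') i 0 * (x - y') j 0)))
    (Mxx i j - m * (y' i 0 * y' j 0)).
  apply: (has_int_eq (has_intD (has_intB (hxx i j) (has_intZ (y' j 0) (hx i)))
    (has_intB (has_intZ (y' i 0 * y' j 0) h0) (has_intZ (y' i 0) (hx j))))) => [q|].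
    by rewrite /on6; move: (vec3 q.1) (vec3 q.2) => x v; rewrite !mxE; ring.
  by rewrite !yE; ring.
have cxv i j : has_int (@leb6 R)
    (on6 (fun x v => F x v * ((x - y') i 0 * (v - z') j 0)))
    (Mxv i j - m * (y' i 0 * z' j 0)).
  apply: (has_int_eq (has_intD (has_intB (hxv i j) (has_intZ (z' j 0) (hx i)))
    (has_intB (has_intZ (y' i 0 * z' j 0) h0) (has_intZ (y' i 0) (hv j))))) => [q|].
    by rewrite /on6; move: (vec3 q.1) (vec3 q.2) => x v; rewrite !mxE; ring.
  by rewrite yE zE; ring.
have cvv i j : has_int (@leb6 R)
    (on6 (fun x v => F x v * ((v - z') i 0 * (v - z') j 0)))
    (Mvv i j - m * (z' i 0 * z' j 0)).
  apply: (has_int_eq (has_intD (has_intB (hvv i j) (has_intZ (z' j 0) (hv i)))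
    (has_intB (has_intZ (z' i 0 * z' j 0) h0) (has_intZ (z' i 0) (hv j))))) => [q|].
    by rewrite /on6; move: (vec3 q.1) (vec3 q.2) => x v; rewrite !mxE; ring.
  by rewrite !zE; ring.
have hS := has_int_sum (index_enum _) predT
  (fun i => has_intD (has_intD (has_intZ k1 (cxx i i)) (has_intZ k2 (cxv i i)))
                     (has_intZ k3 (cvv i i))).
have hK := has_int_sum (index_enum _) predT
  (fun i => has_int_sum (index_enum _) predT (fun j => has_intZ (K i j) (cxv i j))).
apply: (has_int_eq (has_intD hS hK)) => [q|].
  rewrite /on6; move: (vec3 q.1 - y') (vec3 q.2 - z') => x v.
  by move: (F _ _) => f; rewrite /sqn /dot !sum3 !mxE !sum3 !sK; ring.
rewrite !trE /sqn /dot !sum3 /wedge.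
have WE i j : (m^-1 *: (Mxv - Mxv^T) - (y' *m z'^T - z' *m y'^T)) i j =
    m^-1 * (Mxv i j - Mxv j i) - (y' i 0 * z' j 0 - z' i 0 * y' j 0).
  by rewrite !mxE !big_ord1 !mxE.
by rewrite !WE !sK; field.
Qed.

(** The Cauchy-Schwarz inequality for xi = x - y and eta = v - z in a form that
    sees the angular momentum.  Put S = r ^ 2 + axsq W and P = r xi - W xi; then
    P . eta has mean S and |P| ^ 2 <= S |xi| ^ 2, so the mean of the nonnegative
    quantity u ^ 2 S |xi| ^ 2 - 2 u S P . eta + S ^ 2 |eta| ^ 2 is u S (s u - S).
    If S > 0, it is positive because that quantity vanishes only where
    u P = S eta, which is a null set. *)
Lemma calI_admissible (V : septuple R) : calI V -> admissible (central V).
Proof.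
move=> [F [mF F0 /andP[Fw0 Fwoo] ->]].
have [m [y [z [Mxx [Mxv [Mvv h]]]]]] := weighted_has_moments mF F0 Fwoo.
have w0 (q : mR3 R * mR3 R) : 0 <= on6 (fun x v => 1 + sqn x + sqn v) q :> R.
  by rewrite !addr_ge0 ?sqn_ge0.
have pos (g : 'cV[R]_3 -> 'cV[R]_3 -> R) c N :
    has_int (@leb6 R) (on6 (fun x v => F x v * g x v)) c ->
    (forall x v, 0 <= g x v) -> measurable N /\ @leb6 R N = 0%E ->
    (forall q, ~ N q -> 0 < on6 g q) -> 0 < c.
  move=> hg g0 [mN N0] gN.
  exact: (@has_int_weight_gt0 _ _ _ (@leb6 R) (on6 F) (on6 g)
    (on6 (fun x v => 1 + sqn x + sqn v)) c N mF measurable_weight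
    (fun q => F0 _ _) (fun q => g0 _ _) w0 hg Fw0 mN N0 gN).
have m0 : 0 < m.
  apply: (pos (fun _ _ => 1) m set0) => //.
  by case: h => h0 _ _ _ _; apply: (has_int_eq h0) => // q; rewrite /on6 mulr1.
have mn0 : m != 0 by rewrite gt_eqF.
have cen k1 k2 k3 K := @has_moments_central F m y z Mxx Mxv Mvv k1 k2 k3 K mn0 h.
have PE := has_moments_Psi0 h.
have Wsk : let '(_, _, _, _, _, _, W) := central (Psi0 F) in W^T = - W.
  rewrite PE /= /wedge; apply/matrixP => i j; rewrite !mxE !big_ord1 !mxE; ring.
have mE : let '(m', _, _, _, _, _, _) := central (Psi0 F) in m' = m by rewrite PE.
case: (central (Psi0 F)) cen Wsk mE => [[[[[[m' y'] z'] s] r] u] W] cen sW -> /=.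
have sW0 := skewE sW; have O0 : (0 : 'M[R]_3)^T = - 0 by rewrite trmx0 oppr0.
have sqn_gt0 (a b : 'cV[R]_3) : a 0 0 <> b 0 0 -> 0 < sqn (a - b).
  move=> ab; rewrite lt_def sqn_ge0 andbT; apply/eqP => /sqn_eq0 E.
  by apply: ab; have /matrixP/(_ 0 0) := E; rewrite !mxE => /eqP;
    rewrite subr_eq0 => /eqP.
have d0 (a : 'cV[R]_3) : dot a 0 = 0.
  by rewrite /dot big1// => i _; rewrite mxE mulr0.
have s0 : 0 < s.
  have /(pos (fun x v => sqn (x - y')) (m * s)) : has_int (@leb6 R)
      (on6 (fun x v => F x v * sqn (x - y'))) (m * s).
    apply: (has_int_eq (cen 1 0 0 0 O0)) => [q|]; last by rewrite !mxE; ring.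
    by rewrite /on6 mul0mx d0; ring.
  move=> /(_ _ (fun x v => sqn_ge0 _) (leb6_vertical (y' 0 0))).
  rewrite pmulr_rgt0//; apply=> q qN; apply: sqn_gt0.
  by rewrite vec3E.
have u0 : 0 < u.
  have /(pos (fun x v => sqn (v - z')) (m * u)) : has_int (@leb6 R)
      (on6 (fun x v => F x v * sqn (v - z'))) (m * u).
    apply: (has_int_eq (cen 0 0 1 0 O0)) => [q|]; last by rewrite !mxE; ring.
    by rewrite /on6 mul0mx d0; ring.
  move=> /(_ _ (fun x v => sqn_ge0 _) (@leb6_graph R (fun=> z' 0 0) (measurable_cst
    _))).
  rewrite pmulr_rgt0//; apply=> q qN; apply: sqn_gt0.
  by rewrite vec3E.
split => //.
pose S := r ^+ 2 + axsq W.
suff : S < s * u by rewrite /S; lra.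
have S_ge0 : 0 <= S by rewrite addr_ge0 ?sqr_ge0 ?axsq_ge0.
have [S0|Sn0] := eqVneq S 0; first by rewrite S0 mulr_gt0.
have S0 : 0 < S by rewrite lt_def Sn0.
pose P (xi : 'cV[R]_3) := r *: xi - W *m xi.
pose g (x v : 'cV[R]_3) := u ^+ 2 * S * sqn (x - y') - 2 * u * S *
  (r * dot (x - y') (v - z') + dot (x - y') (W *m (v - z'))) + S ^+ 2 * sqn (v - z').
(* The last square is axsq W |xi| ^ 2 - |W xi| ^ 2. *)
have gE x v : g x v = sqn (u *: P (x - y') - S *: (v - z')) +
    u ^+ 2 * (W o2 1 * (x - y') 0 0 - W o2 0 * (x - y') 1 0 + W 1 0 * (x - y') o2
      0) ^+ 2.
  rewrite /g /P /S; move: (x - y') (v - z') => xi eta.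
  by rewrite /sqn /dot /axsq !(mxE, sum3) /= !sW0; ring.
have hg : has_int (@leb6 R) (on6 (fun x v =>
  F x v * g x v)) (m * (u * S * (s * u - S))).
  have sK : ((- (2 * u * S)) *: W)^T = - ((- (2 * u * S)) *: W).
    by rewrite linearZ/= sW scalerN.
  apply: (has_int_eq (cen (u ^+ 2 * S) (- (2 * u * S * r)) (S ^+ 2) _ sK)) => [q|].
    rewrite /on6 /g -scalemxAl.
    have dZ (a b : 'cV[R]_3) k : dot a (k *: b) = k * dot a b.
      by rewrite /dot mulr_sumr; apply: eq_bigr => i _; rewrite mxE; ring.
    by rewrite dZ; ring.
  by rewrite !mxE /S /axsq; ring.
have mP : measurable_fun [set: mR3 R] (fun p => z' 0 0 + u / S * P (vec3 p - y') 0 0).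
  have -> : (fun p : mR3 R => z' 0 0 + u / S * P (vec3 p - y') 0 0) =
    (fun p => z' 0 0 + u / S * (r * (vec3 p 0 0 - y' 0 0) -
      (W 0 0 * (vec3 p 0 0 - y' 0 0) + W 0 1 * (vec3 p 1 0 - y' 1 0) +
       W 0 o2 * (vec3 p o2 0 - y' o2 0)))).
    by apply/funext => p; rewrite /P; move: (vec3 p) => x; rewrite !(mxE, sum3).
  have mB i : measurable_fun [set: mR3 R] (fun p => vec3 p i 0 - y' i 0).
    by apply: measurable_funB => //; exact: measurable_vec3.
  apply: measurable_funD => //; apply: measurable_funM => //.
  apply: measurable_funB; first exact: measurable_funM.
  by apply: measurable_funD; [apply: measurable_funD|]; apply: measurable_funM.
have := pos g _ _ hg _ (leb6_graph mP).
rewrite pmulr_rgt0// pmulr_rgt0 ?mulr_gt0// subr_gt0; apply.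
  by move=> x v; rewrite gE addr_ge0 ?sqn_ge0// mulr_ge0 ?sqr_ge0.
move=> q qN; rewrite /on6 gE; apply: ltr_wpDr.
  by rewrite mulr_ge0// sqr_ge0.
apply: sqn_gt0 => E; apply: qN => /=.
have {}E : u * P (vec3 q.1 - y') 0 0 = S * (q.2.1.1 - z' 0 0).
  by move: E; rewrite !mxE.
by rewrite mulrAC E; field.
Qed.

End calI.

(** * Lipschitz bounds at a point *)

Section norm2.
Context {R : realType}.
Implicit Types p : septuple R.

Definition all_entries (P : R -> Prop) (p : septuple R) : Prop :=
  [/\ P p.1.1.1.1.1.1,
      (forall i, P (p.1.1.1.1.1.2 i 0)) /\ (forall i, P (p.1.1.1.1.2 i 0)),
      [/\ P p.1.1.1.2, P p.1.1.2 & P p.1.2]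
    & forall i j, P (p.2 i j)].

Lemma norm2_ge0 p : 0 <= norm2 p.
Proof. by case: p => [[[[[[m y] z] s] r] u] W]; exact: sqrtr_ge0. Qed.

Lemma entry_le_norm2 p : all_entries (fun e => `|e| <= norm2 p) p.
Proof.
case: p => [[[[[[m y] z] s] r] u] W]; set N := norm2 _.
have m0 := sqr_ge0 m; have s0 := sqr_ge0 s; have r0 := sqr_ge0 r.
have u0 := sqr_ge0 u; have y0 := sqn_ge0 y; have z0 := sqn_ge0 z.
have W0 : 0 <= \sum_(i < 3) \sum_(j < 3) W i j ^+ 2.
  by rewrite sumr_ge0// => i _; rewrite sumr_ge0// => j _; rewrite sqr_ge0.
have h (e : R) : e ^+ 2 <= m ^+ 2 + sqn y + sqn z + s ^+ 2 + r ^+ 2 + u ^+ 2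
    + \sum_(i < 3) \sum_(j < 3) W i j ^+ 2 -> `|e| <= N.
  by move=> e2; rewrite -sqrtr_sqr /N /norm2 ler_wsqrtr.
rewrite /all_entries /=; split; [|split=> i|split|move=> i j]; apply: h; try lra.
- by have := sqr_le_sqn y i; lra.
- by have := sqr_le_sqn z i; lra.
- have : W i j ^+ 2 <= \sum_(i < 3) \sum_(j < 3) W i j ^+ 2; last by lra.
  rewrite (bigD1 i)//= (bigD1 j)//= -addrA lerDl addr_ge0//.
    by rewrite sumr_ge0// => l _; rewrite sqr_ge0.
  by rewrite sumr_ge0// => l _; rewrite sumr_ge0// => l' _; rewrite sqr_ge0.
Qed.

Lemma entry_dist_norm2 (p q : septuple R) :
  [/\ `|p.1.1.1.1.1.1 - q.1.1.1.1.1.1| <= norm2 (p - q),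
      (forall i, `|p.1.1.1.1.1.2 i 0 - q.1.1.1.1.1.2 i 0| <= norm2 (p - q)) /\
      (forall i, `|p.1.1.1.1.2 i 0 - q.1.1.1.1.2 i 0| <= norm2 (p - q)),
      [/\ `|p.1.1.1.2 - q.1.1.1.2| <= norm2 (p - q),
          `|p.1.1.2 - q.1.1.2| <= norm2 (p - q)
        & `|p.1.2 - q.1.2| <= norm2 (p - q)]
    & forall i j, `|p.2 i j - q.2 i j| <= norm2 (p - q)].
Proof.
have sub1 (U W : zmodType) (a b : U * W) : (a - b).1 = a.1 - b.1 by [].
have sub2 (U W : zmodType) (a b : U * W) : (a - b).2 = a.2 - b.2 by [].
have subE m n (A B : 'M[R]_(m, n)) i j : (A - B) i j = A i j - B i j.
  by rewrite !mxE.
have := entry_le_norm2 (p - q); move: (norm2 _) => e.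
by rewrite /all_entries !sub1 !sub2 => -[hm [hy hz] hs hW]; split=> //;
  [split=> i|move=> i j]; rewrite -subE.
Qed.

Lemma norm2_le p e : 0 <= e -> all_entries (fun a => `|a| <= e) p -> norm2 p <= 5 * e.
Proof.
case: p => [[[[[[m y] z] s] r] u] W] e0; rewrite /all_entries /= =>
  -[hm [hy hz] [hs hr hu] hW].
have sq (a : R) : `|a| <= e -> a ^+ 2 <= e ^+ 2.
  by move=> ae; rewrite -(real_normK (num_real a)) lerXn2r.
rewrite /norm2 -(ger0_norm (mulr_ge0 (ler0n R 5) e0)) -sqrtr_sqr ler_wsqrtr//.
rewrite /sqn /dot !sum3 exprMn.
have := sq _ hm; have := sq _ hs; have := sq _ hr; have := sq _ hu.
have := sq _ (hy 0); have := sq _ (hy 1); have := sq _ (hy o2).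
have := sq _ (hz 0); have := sq _ (hz 1); have := sq _ (hz o2).
have := sq _ (hW 0 0); have := sq _ (hW 0 1); have := sq _ (hW 0 o2).
have := sq _ (hW 1 0); have := sq _ (hW 1 1); have := sq _ (hW 1 o2).
have := sq _ (hW o2 0); have := sq _ (hW o2 1); have := sq _ (hW o2 o2).
have := sqr_ge0 e.
by rewrite -!expr2; lra.
Qed.

End norm2.

Section calm.
Context {R : realType} (V1 : septuple R).
Local Notation N V := (norm2 (V1 - V)).

(** A pointwise Lipschitz bound at V1, uniform in the parameter w up to the
    weight h.  One constant controls the size, the Lipschitz bound and the
    radius of the neighbourhood, so that bounds are combined by enlarging it. *)
Definition calm_with T (h : T -> R) (g : septuple R -> T -> R) (C : R) : Prop :=
  [/\ 0 < C, forall w, `|g V1 w| <= C * h w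
    & forall V, C * N V < 1 -> forall w, `|g V1 w - g V w| <= C * N V * h w].

Definition calm T (h : T -> R) (g : septuple R -> T -> R) : Prop :=
  exists C, calm_with h g C.

Lemma calm_withW T (h : T -> R) g C C' : (forall w, 0 <= h w) -> C <= C' ->
  calm_with h g C -> calm_with h g C'.
Proof.
move=> h0 CC' [C0 gb gL]; split.
- exact: lt_le_trans CC'.
- by move=> w; rewrite (le_trans (gb w))// ler_wpM2r.
- move=> V lt1 w; have N0 := norm2_ge0 (V1 - V).
  have := gL V (le_lt_trans (ler_wpM2r N0 CC') lt1) w.
  by move=> /le_trans; apply; rewrite ler_wpM2r// ler_wpM2r.
Qed.

Lemma calm_eq T (h h' : T -> R) f g : calm h f -> h =1 h' ->
  (forall V w, f V w = g V w) -> calm h' g.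
Proof.
move=> [C [C0 fb fL]] /funext <- fg; exists C; split => // [w|V lt1 w].
  by rewrite -fg.
by rewrite -!fg; exact: fL.
Qed.

Lemma calm_cst T (h g : T -> R) : (forall w, `|g w| <= h w) -> calm h (fun=> g).
Proof.
move=> gh; exists 1; split=> [//|w|V _ w]; first by rewrite mul1r.
by rewrite subrr normr0 !mulr_ge0 ?norm2_ge0// (le_trans _ (gh w)).
Qed.

Lemma calmD T (h : T -> R) f g : (forall w, 0 <= h w) ->
  calm h f -> calm h g -> calm h (fun V w => f V w + g V w).
Proof.
move=> h0 [C1 [C10 f1 fL]] [C2 [C20 g1 gL]]; exists (C1 + C2); split.
- exact: addr_gt0.
- by move=> w; rewrite mulrDl (le_trans (ler_normD _ _))// lerD.
- move=> V; have N0 := norm2_ge0 (V1 - V); rewrite !mulrDl => lt1 w.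
  have C1N : 0 <= C1 * N V by rewrite mulr_ge0// ltW.
  have C2N : 0 <= C2 * N V by rewrite mulr_ge0// ltW.
  rewrite mulrDl opprD addrACA (le_trans (ler_normD _ _))// lerD//.
    by apply: fL; lra.
  by apply: gL; lra.
Qed.

Lemma calmM T (h k : T -> R) f g :
  (forall w, 0 <= h w) -> (forall w, 0 <= k w) -> calm h f -> calm k g ->
  calm (fun w => h w * k w) (fun V w => f V w * g V w).
Proof.
move=> h0 k0 [C1 [C10 f1 fL]] [C2 [C20 g1 gL]].
have C12 : 0 < C1 * C2 by exact: mulr_gt0.
exists (C1 * (2 * C2 + 1) + C2); split; first by rewrite addr_gt0// mulr_gt0//; lra.
- move=> w; rewrite normrM; apply: (le_trans (ler_pM _ _ (f1 w) (g1 w))) => //.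
  by rewrite mulrACA ler_wpM2r ?mulr_ge0//; nra.
- move=> V lt1 w; set n := N V in lt1 *; have n0 : 0 <= n := norm2_ge0 _.
  have C1n : 0 <= C1 * n by rewrite mulr_ge0// ltW.
  have C2n : 0 <= C2 * n by rewrite mulr_ge0// ltW.
  have C12n : 0 <= C1 * C2 * n by rewrite mulr_ge0// ltW.
  have lt2 : C1 * n < 1 by nra.
  have lt3 : C2 * n < 1 by nra.
  have fd := fL V lt2 w; have gd := gL V lt3 w; rewrite -/n in fd gd.
  have -> : f V1 w * g V1 w - f V w * g V w =
    f V1 w * (g V1 w - g V w) + (f V1 w - f V w) * (g V1 w - (g V1 w - g V w)) by ring.
  apply: (le_trans (ler_normD _ _)); rewrite !normrM.
  have b1 : `|f V1 w| * `|g V1 w - g V w| <= C1 * h w * (C2 * n * k w) by exact: ler_pM.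
  have b2 : `|f V1 w - f V w| * `|g V1 w - (g V1 w - g V w)| <=
      C1 * n * h w * (C2 * k w + k w).
    apply: ler_pM => //; apply: (le_trans (ler_normB _ _)); apply: lerD => //.
    apply: (le_trans gd); rewrite ler_piMl//; exact: ltW.
  apply: (le_trans (lerD b1 b2)).
  have hk : 0 <= h w * k w by rewrite mulr_ge0.
  rewrite [leLHS](_ : _ = (C1 * (2 * C2 + 1)) * n * (h w * k w)); last by ring.
  by rewrite ler_wpM2r// ler_wpM2r// lerDl ltW.
Qed.

Section scalar.
Variables (T : Type) (t0 : T).
Implicit Types f g : septuple R -> R.
Local Notation calm1 f := (calm (fun _ : T => 1 : R) (fun V (_ : T) => f V)).

Lemma calm1M f g : calm1 f -> calm1 g -> calm1 (fun V => f V * g V).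
Proof.
move=> cf cg; apply: (calm_eq (calmM _ _ cf cg)) => // w; exact: mulr1.
Qed.

Lemma calm1D f g : calm1 f -> calm1 g -> calm1 (fun V => f V + g V).
Proof. by move=> cf cg; exact: (calmD _ cf cg). Qed.

Lemma calm1_cst (k : R) : calm1 (fun=> k).
Proof.
exists (`|k| + 1); split=> [|w|V _ w]; first by rewrite ltr_wpDl.
  by rewrite mulr1 lerDl.
by rewrite subrr normr0 !mulr_ge0 ?norm2_ge0// addr_ge0.
Qed.

Lemma calm1B f g : calm1 f -> calm1 g -> calm1 (fun V => f V - g V).
Proof.
move=> cf cg; apply: (calm_eq (calm1D cf (calm1M (calm1_cst (-1)) cg))) => // V w.
by rewrite mulN1r.
Qed.

Lemma calm1V f : f V1 != 0 -> calm1 f -> calm1 (fun V => (f V)^-1).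
Proof.
move=> f0 [C [C0 /(_ t0) fb fL']]; have {fL'}fL V h := fL' V h t0; set a := `|f V1|.
have a0 : 0 < a by rewrite normr_gt0.
exists (C + 2 * C / a + 2 * C / a ^+ 2 + a^-1); have ? := ltW a0.
have p1 : 0 < 2 * C / a by rewrite divr_gt0// mulr_gt0.
have p2 : 0 < 2 * C / a ^+ 2 by rewrite divr_gt0 ?exprn_gt0// mulr_gt0.
have p3 : 0 < a^-1 by rewrite invr_gt0.
split; first lra.
  by move=> _; rewrite normfV -/a mulr1; lra.
move=> V; set n := N V => lt1 _; have n0 : 0 <= n := norm2_ge0 _.
rewrite !mulrDl in lt1.
have q0 : 0 <= C * n by rewrite mulr_ge0// ltW.
have q1 : 0 <= 2 * C / a * n by rewrite mulr_ge0// ltW.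
have q2 : 0 <= 2 * C / a ^+ 2 * n by rewrite mulr_ge0// ltW.
have q3 : 0 <= a^-1 * n by rewrite mulr_ge0// ltW.
have := fL V ltac:(rewrite -/n; lra); rewrite -/n mulr1 => d.
have Cn : C * n < a / 2.
  have : 2 * C / a * n < 1 by lra.
  by rewrite mulrAC ltr_pdivrMr// mul1r -mulrA; lra.
have fa : a / 2 <= `|f V|.
  have := ler_normD (f V1 - f V) (f V); rewrite subrK -/a; lra.
have fV0 : f V != 0 by rewrite -normr_gt0; lra.
rewrite mulr1 (_ : _ - _ = - (f V1 - f V) / (f V1 * f V)); last by field;
  rewrite f0 fV0.
rewrite normrM normrN normfV normrM -/a.
apply: (@le_trans _ _ (2 * C / a ^+ 2 * n)); last by rewrite !mulrDl; lra.
rewrite ler_pdivrMr ?mulr_gt0 ?normr_gt0//; apply: (le_trans d).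
rewrite (_ : 2 * C / a ^+ 2 * n * (a * `|f V|) = C * n * (2 * `|f V| / a)); last first.
  by field; rewrite gt_eqF.
by rewrite ler_peMr// ler_pdivlMr// mul1r; lra.
Qed.

(** |sqrt a - sqrt b| <= |a - b| / sqrt a holds for a > 0 and every b, the square
    root of a negative number being 0. *)
Lemma calm1_sqrt f : 0 < f V1 -> calm1 f -> calm1 (fun V => Num.sqrt (f V)).
Proof.
move=> f0 [C [C0 /(_ t0) fb fL']]; have {fL'}fL V h := fL' V h t0;
  set a := Num.sqrt (f V1).
have a0 : 0 < a by rewrite sqrtr_gt0.
have p1 : 0 < C / a by rewrite divr_gt0.
exists (C + C / a + a); split; first lra.
  by move=> _; rewrite -/a mulr1 gtr0_norm//; lra.
move=> V; set n := N V => lt1 _; have n0 : 0 <= n := norm2_ge0 _.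
rewrite !mulrDl in lt1.
have q0 : 0 <= C * n by rewrite mulr_ge0// ltW.
have q1 : 0 <= C / a * n by rewrite mulr_ge0// ltW.
have q2 : 0 <= a * n by rewrite mulr_ge0// ltW.
have := fL V ltac:(rewrite -/n; lra); rewrite -/n mulr1 => d.
rewrite mulr1; apply: (@le_trans _ _ (C / a * n)); last by rewrite !mulrDl; lra.
rewrite mulrAC ler_pdivlMr// (le_trans _ d)//.
have a2 : a ^+ 2 = f V1 by rewrite sqr_sqrtr// ltW.
have b0 : 0 <= Num.sqrt (f V) by exact: sqrtr_ge0.
have [fV0|fV0] := leP 0 (f V).
  have b2 : Num.sqrt (f V) ^+ 2 = f V by rewrite sqr_sqrtr.
  rewrite -/a [leRHS](_ : _ = `|a ^+ 2 - Num.sqrt (f V) ^+ 2|); last by rewrite a2 b2.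
  rewrite subr_sqr normrM ler_wpM2l// ger0_norm; lra.
rewrite (ler0_sqrtr (ltW fV0)) -/a subr0 gtr0_norm// -expr2 a2 ger0_norm; lra.
Qed.

End scalar.
End calm.

(** * Stability of the parameters *)

Section stability.
Context {R : realType} (V1 : septuple R).
Hypothesis adm1 : admissible (central V1).
Variables (T : Type) (t0 : T).
Local Notation N V := (norm2 (V1 - V)).
Local Notation calm1 f := (calm V1 (fun _ : T => 1 : R) (fun V (_ : T) => f V)).

Definition calm_entries (P : septuple R -> septuple R) : Prop :=
  [/\ calm1 (fun V => (P V).1.1.1.1.1.1),
      (forall i, calm1 (fun V => (P V).1.1.1.1.1.2 i 0)) /\
      (forall i, calm1 (fun V => (P V).1.1.1.1.2 i 0)),
      [/\ calm1 (fun V => (P V).1.1.1.2), calm1 (fun V => (P V).1.1.2)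
        & calm1 (fun V => (P V).1.2)]
    & forall i j, calm1 (fun V => (P V).2 i j)].

Lemma calm_lip (f : septuple R -> R) :
  (forall V, `|f V1 - f V| <= N V) -> calm1 f.
Proof.
move=> fL; exists (`|f V1| + 1); split=> [|w|V _ w]; first by rewrite ltr_wpDl.
  by rewrite mulr1 lerDl.
by rewrite mulr1 (le_trans (fL V))// ler_peMl ?norm2_ge0// lerDr.
Qed.

Lemma calm_entries_id : calm_entries id.
Proof.
have H V := entry_dist_norm2 V1 V.
by split; [|split=> i|split|move=> i j]; apply: calm_lip => V;
  have [hm [hy hz] [hs hr hu] hW] := H V.
Qed.

Let cM (f g : septuple R -> R) : calm1 f -> calm1 g -> calm1 (fun V => f V * g V).
Proof. exact: calm1M. Qed.
Let cD (f g : septuple R -> R) : calm1 f -> calm1 g -> calm1 (fun V => f V + g V).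
Proof. exact: calm1D. Qed.
Let cB (f g : septuple R -> R) : calm1 f -> calm1 g -> calm1 (fun V => f V - g V).
Proof. exact: calm1B. Qed.
Let cV (f : septuple R -> R) : f V1 != 0 -> calm1 f -> calm1 (fun V => (f V)^-1).
Proof. exact: (calm1V t0). Qed.
Let cC (k : R) : calm1 (fun=> k). Proof. exact: calm1_cst. Qed.

Lemma calm1_eq (f g : septuple R -> R) : calm1 f -> f =1 g -> calm1 g.
Proof. by move=> cf fg; apply: (calm_eq cf). Qed.

Lemma calm_entries_central : calm_entries central.
Proof.
have [hm [hy hz] [hs hr hu] hW] := calm_entries_id.
have m0 : V1.1.1.1.1.1.1 != 0.
  move: adm1; case: V1 => [[[[[[m1 y1] z1] s1] r1] u1] W1] [m0 *].
  by rewrite gt_eqF.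
have hmV := cV m0 hm.
have hy' i := cM hmV (hy i); have hz' i := cM hmV (hz i).
split; [|split=> i|split|move=> i j].
- by apply: (calm1_eq hm); case=> [[[[[[m y] z] s] r] u] W].
- by apply: (calm1_eq (hy' i)); case=> [[[[[[m y] z] s] r] u] W] /=; rewrite mxE.
- by apply: (calm1_eq (hz' i)); case=> [[[[[[m y] z] s] r] u] W] /=; rewrite mxE.
- apply: (calm1_eq (cB (cM hs hmV) (cD (cD (cM (hy' 0) (hy' 0))
    (cM (hy' 1) (hy' 1))) (cM (hy' o2) (hy' o2))))).
  by case=> [[[[[[m y] z] s] r] u] W] /=; rewrite /sqn /dot sum3 !mxE.
- apply: (calm1_eq (cB (cM hr hmV) (cD (cD (cM (hy' 0) (hz' 0))
    (cM (hy' 1) (hz' 1))) (cM (hy' o2) (hz' o2))))).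
  by case=> [[[[[[m y] z] s] r] u] W] /=; rewrite /sqn /dot sum3 !mxE.
- apply: (calm1_eq (cB (cM hu hmV) (cD (cD (cM (hz' 0) (hz' 0))
    (cM (hz' 1) (hz' 1))) (cM (hz' o2) (hz' o2))))).
  by case=> [[[[[[m y] z] s] r] u] W] /=; rewrite /sqn /dot sum3 !mxE.
- apply: (calm1_eq (cB (cM hmV (hW i j))
    (cB (cM (hy' i) (hz' j)) (cM (hz' i) (hy' j))))).
  by case=> [[[[[[m y] z] s] r] u] W] /=; rewrite /wedge !mxE !big_ord1 !mxE.
Qed.

(** The formulas of [central_params] use only field operations and square roots,
    and at an admissible point no denominator or radicand vanishes. *)
Lemma calm_entries_params : calm_entries moments_params.
Proof.
have [hm [hy hz] [hs hr hu] hW] := calm_entries_central.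
pose D (V : septuple R) := (central V).1.1.1.2 * (central V).1.2 -
  (central V).1.1.2 * (central V).1.1.2.
pose w (V : septuple R) := (central V).2 1 0 * (central V).2 1 0 +
  (central V).2 o2 0 * (central V).2 o2 0 + (central V).2 o2 1 * (central V).2 o2 1.
have hD : calm1 D := cB (cM hs hu) (cM hr hr).
have hw : calm1 w := cD (cD (cM (hW _ _) (hW _ _)) (cM (hW _ _) (hW _ _)))
  (cM (hW _ _) (hW _ _)).
have [w0 lt] : 0 <= w V1 /\ w V1 < D V1.
  rewrite /w /D; case: (central V1) adm1 => [[[[[[m y] z] s] r] u] W] /=.
  move=> [m0 s0 u0 sW]; rewrite /axsq !expr2 => lt; split => //.
  by rewrite -!expr2 !addr_ge0 ?sqr_ge0.
have D0 : 0 < D V1 by exact: le_lt_trans lt.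
pose k (V : septuple R) := Num.sqrt (1 + 3 * w V * (D V)^-1).
have q1 : w V1 * (D V1)^-1 < 1 by rewrite ltr_pdivrMr// mul1r.
have q0 : 0 <= w V1 * (D V1)^-1 by rewrite divr_ge0// ltW.
have k2 : k V1 ^+ 2 = 1 + 3 * (w V1 * (D V1)^-1).
  by rewrite /k -mulrA sqr_sqrtr// addr_ge0// mulr_ge0.
have k_ge0 : 0 <= k V1 by exact: sqrtr_ge0.
have k_lt2 : k V1 < 2 by nra.
have hDV : calm1 (fun V => (D V)^-1) by apply: cV => //; rewrite gt_eqF.
have hk : calm1 k.
  apply: (calm1_sqrt t0); last exact: (cD (cC 1) (cM (cM (cC 3) hw) hDV)).
  by rewrite -mulrA ltr_pwDl// mulr_ge0.
pose h (V : septuple R) := D V * (2 - k V).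
have hh : calm1 h := cM hD (cB (cC 2) hk).
have h0 : 0 < h V1 by rewrite mulr_gt0// subr_gt0.
have hhV : calm1 (fun V => (h V)^-1) by apply: cV => //; rewrite gt_eqF.
have hk1 : calm1 (fun V => (h V * (k V + 1))^-1).
  apply: cV; last exact: (cM hh (cD hk (cC 1))).
  by rewrite gt_eqF// mulr_gt0// ltr_wpDl.
have E V : moments_params V =
    ((central V).1.1.1.1.1.1, (central V).1.1.1.1.1.2, (central V).1.1.1.1.2,
     3 * (central V).1.2 * (h V)^-1, - (3 * (central V).1.1.2 * (h V)^-1),
     3 * (central V).1.1.1.2 * (h V)^-1,
     (- (9 * (h V * (k V + 1))^-1)) *: (central V).2).
  rewrite /moments_params /h /k /w /D.
  by case: (central V) => [[[[[[m y] z] s] r] u] W] /=; rewrite /axsq !expr2.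
split; [|split=> i|split|move=> i j].
- by apply: (calm1_eq hm) => V; rewrite E.
- by apply: (calm1_eq (hy i)) => V; rewrite E.
- by apply: (calm1_eq (hz i)) => V; rewrite E.
- by apply: (calm1_eq (cM (cM (cC 3) hu) hhV)) => V; rewrite E.
- by apply: (calm1_eq (cM (cM (cC (-3)) hr) hhV)) => V; rewrite E /= !mulNr.
- by apply: (calm1_eq (cM (cM (cC 3) hs) hhV)) => V; rewrite E.
- by apply: (calm1_eq (cM (cM (cC (-9)) hk1) (hW i j))) => V; rewrite E /= mxE mulNr.
Qed.

End stability.

(** * The bijection and its stability *)

Section calM.
Context {R : realType}.

Lemma maxwell_gt0 (p : septuple R) t x v : maxwell_params p -> 0 < maxwell p t x v.
Proof.
case: p => [[[[[[m y] z] a] b] c] A] [m0 /calOE[a0 c0 sA lt]].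
have D0 := le_lt_trans (axsq_ge0 A) lt.
rewrite maxwellE mulr_gt0 ?expR_gt0// mulr_gt0// divr_gt0//.
  by rewrite sqrtr_gt0 det_Q// mulr_gt0// exprn_gt0// subr_gt0.
by rewrite exprn_gt0// mulr_gt0// pi_gt0.
Qed.

Lemma maxwell_moments_calI (p : septuple R) : maxwell_params p ->
  calI (maxwell_moments p).
Proof.
move=> pp; exists (maxwell p 0).
have Mgt0 := fun x v => @maxwell_gt0 p 0 x v pp.
have w0 (x v : 'cV[R]_3) : 0 <= sqn x + sqn v by rewrite addr_ge0 ?sqn_ge0.
split.
- exact: measurable_maxwell0.
- by move=> x v; exact: ltW.
- case: p pp Mgt0 => [[[[[[m y] z] a] b] c] A] [m0 O] Mgt0.
  have h := maxwell0_has_moments m y z O.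
  have [iw Ew] := has_moments_weight h.
  have fin := integrable_fin_num measurableT iw.
  rewrite -(fineK fin) ltry andbT; case: h => [[i0 E0] _ _ _ _].
  rewrite lte_fin; apply: (lt_le_trans m0); rewrite -[leLHS]E0.
  apply: le_Rintegral => // q _.
  by apply: ler_peMr; [exact: ltW|rewrite -addrA lerDl].
- rewrite -(Psi_maxwell 0 pp) /Psi /Psi0.
  have -> : @Xt R 0 = (fun x _ => x).
    by apply/funext => x; apply/funext => v; rewrite Xt0.
  have -> // : @Vt R 0 = (fun _ v => v).
  by apply/funext => x; apply/funext => v; rewrite Vt0.
Qed.

End calM.

Section ratio.
Context {R : realType} (V1 : septuple R).
Hypothesis adm1 : admissible (central V1).
Local Notation N V := (norm2 (V1 - V)).
Local Notation P := moments_params.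

Lemma calm_norm2_params : exists C, 0 < C /\
  forall V, C * N V < 1 -> norm2 (P V1 - P V) <= C * N V.
Proof.
have [hm [hy hz] [hs hr hu] hW] := calm_entries_params adm1 tt.
have fin3 (f : septuple R -> 'I_3 -> R) :
    (forall i, calm V1 (fun _ : unit => 1 : R) (fun V _ => f V i)) ->
    exists C, forall i, calm_with V1 (fun _ : unit => 1 : R) (fun V _ => f V i) C.
  move=> h; have [C0 h0] := h 0; have [C1 h1] := h 1; have [C2 h2] := h o2.
  have [? _ _] := h0; have [? _ _] := h1; have [? _ _] := h2.
  exists (C0 + C1 + C2); apply: ord3P;
    [move: h0|move: h1|move: h2]; apply: calm_withW => //; lra.
have [Cm cm] := hm; have [Cy cy] := fin3 _ hy; have [Cz cz] := fin3 _ hz.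
have [Cs cs] := hs; have [Cr cr] := hr; have [Cu cu] := hu.
have [C0 c0] := fin3 _ (hW 0); have [C1 c1] := fin3 _ (hW 1).
have [C2 c2] := fin3 _ (hW o2).
have [? _ _] := cm; have [? _ _] := cy 0; have [? _ _] := cz 0.
have [? _ _] := cs; have [? _ _] := cr; have [? _ _] := cu.
have [? _ _] := c0 0; have [? _ _] := c1 0; have [? _ _] := c2 0.
pose C := Cm + Cy + Cz + Cs + Cr + Cu + C0 + C1 + C2.
have C_gt0 : 0 < C by rewrite /C; lra.
exists (5 * C); split => [|V lt1]; first lra.
have n0 : 0 <= N V := norm2_ge0 _.
have C1n : C * N V < 1.
  by apply: le_lt_trans lt1; rewrite ler_wpM2r// ler_peMl ?ltW//; lra.
rewrite -mulrA; apply: norm2_le; first by rewrite mulr_ge0// ltW.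
have use (f : septuple R -> R) C' : C' <= C ->
    calm_with V1 (fun _ : unit => 1 : R) (fun V _ => f V) C' ->
    `|f V1 - f V| <= C * N V.
  move=> CC' cf; have [|_ _ /(_ V C1n tt)] := @calm_withW _ _ _ _ _ _ C _ CC' cf => //.
  by rewrite mulr1.
have lCm : Cm <= C by rewrite /C; lra.
have um := use _ _ lCm cm.
have lCy : Cy <= C by rewrite /C; lra.
have uy i := use _ _ lCy (cy i).
have lCz : Cz <= C by rewrite /C; lra.
have uz i := use _ _ lCz (cz i).
have lCs : Cs <= C by rewrite /C; lra.
have us := use _ _ lCs cs.
have lCr : Cr <= C by rewrite /C; lra.
have ur := use _ _ lCr cr.
have lCu : Cu <= C by rewrite /C; lra.
have uu := use _ _ lCu cu.
have lC0 : C0 <= C by rewrite /C; lra.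
have u0 i := use _ _ lC0 (c0 i).
have lC1 : C1 <= C by rewrite /C; lra.
have u1 i := use _ _ lC1 (c1 i).
have lC2 : C2 <= C by rewrite /C; lra.
have u2 i := use _ _ lC2 (c2 i).
move: um uy uz us ur uu u0 u1 u2.
case: (P V1) => [[[[[[m y] z] s] r] u] W];
  case: (P V) => [[[[[[m' y'] z'] s'] r'] u'] W'] /=.
move=> um uy uz us ur uu u0 u1 u2; split => //.
  by split=> i; rewrite !mxE.
by apply: ord3P => j; rewrite !mxE.
Qed.

(** The determinant of Q is written out, so that the factor is visibly composed
    of operations that preserve Lipschitz bounds. *)
Definition maxwell_norm (p : septuple R) : R :=
  let '(m, y, z, a, b, c, A) := p in
  let D := a * c - b ^+ 2 in
  m * (Num.sqrt (D * (D - axsq A) ^+ 2) / (2 * pi) ^+ 3).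

Definition maxwell_form (p : septuple R) (w : 'cV[R]_3 * 'cV[R]_3) : R :=
  let '(m, y, z, a, b, c, A) := p in exponent_form a b c A (w.1 - y) (w.2 - z).

Lemma maxwell_normE (p : septuple R) t x v : maxwell_params p ->
  maxwell p t x v =
  maxwell_norm p * expR (- (2^-1 * maxwell_form p (Xt t x v, Vt t x v))).
Proof.
case: p => [[[[[[m y] z] a] b] c] A] [m0 /calOE[a0 c0 sA lt]].
by rewrite maxwellE det_Q.
Qed.

Lemma maxwell_norm_gt0 (p : septuple R) : maxwell_params p -> 0 < maxwell_norm p.
Proof.
move=> pp; have := maxwell_gt0 0 0 0 pp; rewrite maxwell_normE//.
by rewrite pmulr_lgt0// expR_gt0.
Qed.

Let weight (w : 'cV[R]_3 * 'cV[R]_3) : R := 1 + sqn w.1 + sqn w.2.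

Lemma calm_maxwell_norm :
  calm V1 (fun _ : unit => 1 : R) (fun V _ => maxwell_norm (P V)).
Proof.
have [hm [hy hz] [ha hb hc] hA] := calm_entries_params adm1 tt.
have hD := calm1B (calm1M ha hc) (calm1M hb hb).
have hA' i j := calm1M (hA i j) (hA i j).
have hw := calm1D (calm1D (hA' 1 0) (hA' o2 0)) (hA' o2 1).
have he := calm1B hD hw.
have hs := calm1_sqrt tt _ (calm1M hD (calm1M he he)).
apply: (calm_eq (calm1M hm (calm1M (hs _) (calm1_cst V1 _ ((2 * pi) ^+ 3)^-1)))) => //.
  have [pp _] := moments_paramsK adm1.
  case: (P V1) pp => [[[[[[m y] z] a] b] c] A] [m0 /calOE[a0 c0 sA lt]] /=.
  have D0 := le_lt_trans (axsq_ge0 A) lt.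
  rewrite -!expr2; apply: mulr_gt0; first exact: D0.
  by rewrite exprn_gt0// subr_gt0.
move=> V _; case: (P V) => [[[[[[m y] z] a] b] c] A] /=.
by rewrite /axsq -!expr2.
Qed.

(** The form is a sum of products of three factors: one coefficient, of weight
    1, and two centred coordinates, each of weight the square root of the total
    weight. *)
Lemma calm_maxwell_form : calm V1 weight (fun V w => maxwell_form (P V) w).
Proof.
pose s w := Num.sqrt (weight w).
have wt0 w : 0 <= weight w by rewrite !addr_ge0 ?sqn_ge0.
have s0 w : 0 <= s w by exact: sqrtr_ge0.
have ss w : s w * s w = weight w by rewrite -expr2 sqr_sqrtr.
have s1 w : 1 <= s w.
  by rewrite -[leLHS]sqrtr1 ler_wsqrtr// /weight -addrA lerDl addr_ge0 ?sqn_ge0.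
have [hm [hy hz] [ha hb hc] hA] :=
  calm_entries_params adm1 (0 : 'cV[R]_3 * 'cV[R]_3).
have toS (f : septuple R -> R) :
    calm V1 (fun _ : 'cV[R]_3 * 'cV[R]_3 => 1 : R) (fun V _ => f V) ->
    calm V1 s (fun V _ => f V).
  move=> [C [C0 fb fL]]; exists C; split => [//|w|V lt1 w].
    by rewrite (le_trans (fb w))// ler_wpM2l// ltW.
  by rewrite (le_trans (fL V lt1 w))// ler_wpM2l// mulr_ge0 ?norm2_ge0// ltW.
have hx i : calm V1 s (fun V w => w.1 i 0 - (P V).1.1.1.1.1.2 i 0).
  have c1 : calm V1 s (fun _ w => w.1 i 0).
    apply: calm_cst => w; rewrite -sqrtr_sqr ler_wsqrtr//.
    have := sqr_le_sqn w.1 i; have := sqn_ge0 w.2; rewrite /weight; lra.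
  have c2 := toS _ (calm1M (calm1_cst V1 _ (-1)) (hy i)).
  by apply: (calm_eq (calmD s0 c1 c2)) => // V w; rewrite mulN1r.
have hv i : calm V1 s (fun V w => w.2 i 0 - (P V).1.1.1.1.2 i 0).
  have c1 : calm V1 s (fun _ w => w.2 i 0).
    apply: calm_cst => w; rewrite -sqrtr_sqr ler_wsqrtr//.
    have := sqr_le_sqn w.2 i; have := sqn_ge0 w.1; rewrite /weight; lra.
  have c2 := toS _ (calm1M (calm1_cst V1 _ (-1)) (hz i)).
  by apply: (calm_eq (calmD s0 c1 c2)) => // V w; rewrite mulN1r.
have c3 (f : septuple R -> R) (g k : septuple R -> 'cV[R]_3 * 'cV[R]_3 -> R) :
    calm V1 (fun _ : 'cV[R]_3 * 'cV[R]_3 => 1 : R) (fun V _ => f V) ->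
    calm V1 s g -> calm V1 s k -> calm V1 weight (fun V w => f V * (g V w * k V w)).
  move=> cf cg ck; have := calmM (fun=> ler01) (fun w => mulr_ge0 (s0 w) (s0 w))
    cf (calmM s0 s0 cg ck).
  by move=> /calm_eq; apply => // w; rewrite mul1r ss.
have cS (f : 'I_3 -> septuple R -> 'cV[R]_3 * 'cV[R]_3 -> R) :
    (forall i, calm V1 weight (f i)) -> calm V1 weight (fun V w => \sum_i f i V w).
  move=> cf; apply: (calm_eq (calmD wt0 (calmD wt0 (cf 0) (cf 1)) (cf o2))) => // V w.
  by rewrite sum3.
have t1 := cS _ (fun i => c3 _ _ _ ha (hx i) (hx i)).
have t2 := cS _ (fun i => c3 _ _ _ (calm1M (calm1_cst V1 _ 2) hb) (hx i) (hv i)).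
have t3 := cS _ (fun i => c3 _ _ _ hc (hv i) (hv i)).
have t4 := cS _ (fun i => cS _ (fun j =>
  c3 _ _ _ (calm1M (calm1_cst V1 _ 2) (hA i j)) (hx i) (hv j))).
apply: (calm_eq (calmD wt0 (calmD wt0 (calmD wt0 t1 t2) t3) t4)) => // V w.
case: (P V) => [[[[[[m y] z] a] b] c] A] /=; rewrite /maxwell_form.
by rewrite /exponent_form /sqn /dot !sum3 !(mxE, sum3); ring.
Qed.

(** Near V1 the normalizing factors differ by a factor at most 2, and the
    exponents by a multiple of the distance times 1 + |X| ^ 2 + |V| ^ 2, which is
    1 + |x| ^ 2 + |v| ^ 2; each of the two quotients contributes half of the
    constant 4. *)
Lemma maxwell_ratio : exists C, 0 < C /\
  forall V, admissible (central V) -> C * N V < 1 -> forall t x v,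
  maxwell (P V1) t x v / maxwell (P V) t x v
  + maxwell (P V) t x v / maxwell (P V1) t x v
  <= 4 * expR (C * N V * (sqn x + sqn v + 1)).
Proof.
have [Cn [Cn0 _ hn]] := calm_maxwell_norm.
have [Cq [Cq0 _ hq]] := calm_maxwell_form.
have pp1 := (moments_paramsK adm1).1.
have n1 := maxwell_norm_gt0 pp1; set k1 := maxwell_norm (P V1) in n1 hn.
have p1 : 0 < 2 * Cn / k1 by rewrite divr_gt0// mulr_gt0.
exists (Cn + Cq + 2 * Cn / k1); split; first lra.
move=> V adm; set n := N V => lt1 t x v.
have n0 : 0 <= n := norm2_ge0 _.
rewrite !mulrDl in lt1.
have r1 : 0 <= Cn * n by rewrite mulr_ge0// ltW.
have r2 : 0 <= Cq * n by rewrite mulr_ge0// ltW.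
have r3 : 0 <= 2 * Cn / k1 * n by rewrite mulr_ge0// ltW.
have pp := (moments_paramsK adm).1.
have n2 := maxwell_norm_gt0 pp; set k2 := maxwell_norm (P V) in n2 hn.
have := hn V ltac:(rewrite -/n; lra) tt; rewrite -/n mulr1 => dk.
(* The last summand of the constant was chosen for this bound. *)
have small : Cn * n < k1 / 2.
  have : 2 * Cn / k1 * n < 1 by lra.
  by rewrite mulrAC ltr_pdivrMr// mul1r -mulrA; lra.
have := hq V ltac:(rewrite -/n; lra) (Xt t x v, Vt t x v); rewrite -/n.
have wE : weight (Xt t x v, Vt t x v) = sqn x + sqn v + 1.
  rewrite /weight /= (_ : 1 + _ + _ = (cos t ^+ 2 + sin t ^+ 2) * (sqn x + sqn v) + 1).
    by rewrite cos2Dsin2 mul1r.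
  by rewrite /Xt /Vt /sqn /dot !sum3 !mxE; ring.
rewrite wE; set W := sqn x + sqn v + 1 => dq.
have W0 : 0 <= W by rewrite addr_ge0// addr_ge0 ?sqn_ge0.
rewrite !maxwell_normE//.
move: (maxwell_form (P V1) _) (maxwell_form (P V) _) dq => q1 q2 dq.
have abs1 := ler_norm (q1 - q2).
have abs2 : q2 - q1 <= `|q1 - q2| by rewrite -(distrC q2) ler_norm.
have quo (k k' q q' : R) : 0 < k -> 0 < k' -> k <= 2 * k' ->
    q' - q <= Cq * n * W ->
    k * expR (- (2^-1 * q)) / (k' * expR (- (2^-1 * q'))) <=
    2 * expR ((Cn + Cq + 2 * Cn / k1) * n * W).
  move=> k0 k'0 kk' qq'.
  have -> : k * expR (- (2^-1 * q)) / (k' * expR (- (2^-1 * q'))) =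
      (k / k') * expR (2^-1 * (q' - q)).
    rewrite invfM -expRN opprK mulrACA -expRD; congr (_ * expR _); ring.
  apply: ler_pM; [by rewrite divr_ge0// ltW|exact: expR_ge0| |].
    by rewrite ler_pdivrMr.
  have u1 : 0 <= Cq * n * W by rewrite mulr_ge0.
  have u2 : 0 <= Cn * n * W by rewrite mulr_ge0.
  have u3 : 0 <= 2 * Cn / k1 * n * W by rewrite mulr_ge0.
  by rewrite ler_expR !mulrDl; lra.
have [dk1 dk2] : k1 - k2 <= Cn * n /\ k2 - k1 <= Cn * n.
  by move: dk => /=; rewrite -/k1 -/k2 ler_norml => /andP[d1 d2]; split; lra.
have qA := quo k1 k2 q1 q2 n1 n2 ltac:(lra) ltac:(lra).
have qB := quo k2 k1 q2 q1 n2 n1 ltac:(lra) ltac:(lra).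
by apply: (le_trans (lerD qA qB)); rewrite -mulrDl; lra.
Qed.

End ratio.

Unset Implicit Arguments.
Set Strict Implicit.

Theorem theorem1p2 (R : realType) :
  exists Ft : septuple R -> (R -> 'cV[R]_3 -> 'cV[R]_3 -> R),
  [/\ set_bij (@calI R) (@calM R) Ft,
      forall V, calI V -> forall t : R, Psi (Ft V) t = V
    & forall V1 : septuple R, calI V1 ->
      exists delta C : R, 0 < delta /\
      forall V2 : septuple R, calI V2 -> norm2 (V1 - V2) < delta ->
      forall p1 p2 : septuple R,
      maxwell_params p1 -> maxwell_params p2 ->
      Ft V1 = maxwell p1 -> Ft V2 = maxwell p2 ->
      norm2 (p1 - p2) <= C * norm2 (V1 - V2) /\
      forall (t : R) (x v : 'cV[R]_3),
        Ft V1 t x v / Ft V2 t x v + Ft V2 t x v / Ft V1 t x v <=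
        4 * expR (C * norm2 (V1 - V2) * (sqn x + sqn v + 1))].
Proof.
exists (fun V => maxwell (moments_params V)).
have PsiE (V : septuple R) : calI V -> forall t, Psi (maxwell (moments_params V)) t = V.
  by move=> /calI_admissible /moments_paramsK[pp E] t; rewrite Psi_maxwell.
split => //.
  split.
  - move=> V /calI_admissible /moments_paramsK[pp _]; by exists (moments_params V).
  - move=> V V'; rewrite !inE => IV IV' E.
    by rewrite -(PsiE V IV 0) E PsiE.
  - move=> _ [p pp ->]; exists (maxwell_moments p); first exact: maxwell_moments_calI.
    by rewrite maxwell_momentsK.
move=> V1 I1; have adm1 := @calI_admissible R V1 I1.
have [C1 [C10 h1]] := calm_norm2_params adm1.
have [C2 [C20 h2]] := maxwell_ratio adm1.
exists (C1 + C2)^-1, (C1 + C2); have C0 : 0 < C1 + C2 by exact: addr_gt0.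
split; first by rewrite invr_gt0.
move=> V2 I2 lt p1 p2 pp1 pp2 E1 E2.
have P1 : p1 = moments_params V1.
  by rewrite -(PsiE V1 I1 0) E1 Psi_maxwell// maxwell_momentsK.
have P2 : p2 = moments_params V2.
  by rewrite -(PsiE V2 I2 0) E2 Psi_maxwell// maxwell_momentsK.
have n0 := norm2_ge0 (V1 - V2); set n := norm2 (V1 - V2) in lt n0 *.
have : (C1 + C2) * n < 1 by rewrite -ltr_pdivlMl// mulr1.
rewrite mulrDl => lt1.
have m1 : 0 <= C1 * n by rewrite mulr_ge0// ltW.
have m2 : 0 <= C2 * n by rewrite mulr_ge0// ltW.
have lt_C1 : C1 * n < 1 by lra.
have lt_C2 : C2 * n < 1 by lra.
split.
  by rewrite P1 P2; apply: (le_trans (h1 V2 lt_C1)); rewrite lerDl.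
move=> t x v; apply: (le_trans (h2 V2 (calI_admissible I2) lt_C2 t x v)).
rewrite ler_pM2l// ler_expR ler_wpM2r//.
  by rewrite addr_ge0// addr_ge0 ?sqn_ge0.
by rewrite lerDr.
Qed.
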